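(* Let $k\in\{0,1,2,\dots\}$, $0<\alpha\le 1$, $0<\beta\le 1$, $\lambda\ge 0$, $\delta\ge 0$, $\gamma\ge 0$, and let $\phi(z)=1+B_1z+B_2z^2+B_3z^3+\cdots$ ($z\in U$) with $B_1>0$. Let $f(z)=z+\sum_{n\ge2}a_nz^n$ belong to the class $B^{k,\alpha,\beta,\delta,\lambda}_{\Sigma}(\gamma,\phi)$. Then $$|a_2|\le\frac{B_1\sqrt{2B_1}}{\sqrt{\left|B_1^2\left(2(\gamma+2)\Upsilon_3^kC(\delta,3)+(\gamma-1)(\gamma+2)[\Upsilon_2^kC(\delta,2)]^2\right)-2(B_2-B_1)(\gamma+1)^2[\Upsilon_2^kC(\delta,2)]^2\right|}}$$ and $$|a_3|\le\frac{B_1}{(\gamma+2)\Upsilon_3^kC(\delta,3)}+\left[\frac{B_1}{(\gamma+1)\Upsilon_2^kC(\delta,2)}\right]^2.$$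
   Context: $U=\{z\in\mathbb{C}:|z|<1\}$; $A$ is the class of functions $f(z)=z+\sum_{n\ge2}a_nz^n$ analytic in $U$. A function $f\in A$ is bi-univalent, written $f\in\Sigma$, if $f$ is univalent in $U$ and its inverse $f^{-1}$ (analytic near $0$) extends to a univalent analytic function $g$ on $U$; $g(w)=w-a_2w^2+(2a_2^2-a_3)w^3+\cdots$. For $F,G$ analytic in $U$, $F\prec G$ means $F=G\circ\omega$ for some analytic $\omega:U\to U$ with $\omega(0)=0$. Put $\Upsilon_n^k=[\lambda(\alpha+\beta-1)(n-1)]^k$ (equal to $1$ when $k=0$) and $C(\delta,n)=\binom{n+\delta-1}{\delta}=\frac{\Gamma(n+\delta)}{\Gamma(\delta+1)\Gamma(n)}$. For $h(z)=z+\sum_{n\ge2}c_nz^n\in A$ set $D^k_{\alpha,\beta,\delta,\lambda}h(z)=z+\sum_{n\ge2}\Upsilon_n^kC(\delta,n)c_nz^n$. $f\in\Sigma$ is in $B^{k,\alpha,\beta,\delta,\lambda}_\Sigma(\gamma,\phi)$ if, with $D=D^k_{\alpha,\beta,\delta,\lambda}$ and $g$ the extended inverse of $f$, $$\frac{z^{1-\gamma}(Df(z))'}{[Df(z)]^{1-\gamma}}\prec\phi(z)\quad\text{and}\quad\frac{w^{1-\gamma}(Dg(w))'}{[Dg(w)]^{1-\gamma}}\prec\phi(w),\qquad z,w\in U.$$ Here $\frac{z^{1-\gamma}F'(z)}{F(z)^{1-\gamma}}$ means $F'(z)\,(F(z)/z)^{\gamma-1}$, with the analytic branch of the power equal to $1$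 at $z=0$.
   Formalization: The bound on |a_3| is stated only when Υ_3^k > 0 (its right side is undefined if Υ_3^k = 0, and the bound fails for f(z)=z, small B_1, if Υ_3^k < 0); the bound on |a_2| is stated only when the expression under the modulus in its denominator is nonzero. *)

(* Defs.v *)
From Stdlib Require Import Reals.
From Coquelicot Require Import Coquelicot.

Open Scope R_scope.

Definition disc (r : R) (z : C) : Prop := Cmod z < r.

Definition U : C -> Prop := disc 1.

Definition C_psum (c : nat -> C) (z l : C) : Prop :=
  @is_pseries C_AbsRing C_NormedModule c z l.

Definition analytic_in (D : C -> Prop) (F : C -> C) : Prop :=
  forall z0 : C, D z0 ->
    exists (c : nat -> C) (r : posreal),
      forall z : C, Cmod (z - z0) < r -> C_psum c (z - z0)%C (F z).

Definition univalent (F : C -> C) : Prop :=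
  forall z w : C, U z -> U w -> F z = F w -> z = w.

(* The class A: [h] is analytic in [U] with expansion
   z + c_2 z^2 + c_3 z^3 + ... there.  Functions are total on [C]; their values
   outside [U] are never used. *)
Definition class_A (h : C -> C) (c : nat -> C) : Prop :=
  c 0%nat = RtoC 0 /\ c 1%nat = RtoC 1 /\
  forall z : C, U z -> C_psum c z (h z).

(* [g] agrees near 0 with the inverse f^{-1} : f(U) -> U. *)
Definition extended_inverse (f g : C -> C) : Prop :=
  analytic_in U g /\ univalent g /\
  exists r : posreal, forall z : C, U z -> Cmod (f z) < r -> g (f z) = z.

Definition bi_univalent (f : C -> C) : Prop :=
  (exists a : nat -> C, class_A f a) /\ univalent f /\
  exists g : C -> C, extended_inverse f g.

Definition subordinate (F G : C -> C) : Prop :=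
  exists w : C -> C,
    analytic_in U w /\ w (RtoC 0) = RtoC 0 /\
    forall z : C, U z -> U (w z) /\ F z = G (w z).

(* Euler's integral; only used at arguments >= 1. *)
Definition Gamma (x : R) : R :=
  RInt_gen (fun t : R => Rpower t (x - 1) * exp (- t))
    (at_right 0) (Rbar_locally p_infty).

Definition Cbin (delta : R) (n : nat) : R :=
  Gamma (INR n + delta) / (Gamma (delta + 1) * Gamma (INR n)).

Definition Upsilon (alpha beta lambda : R) (k n : nat) : R :=
  (lambda * (alpha + beta - 1) * (INR n - 1)) ^ k.

Definition D_coef (k : nat) (alpha beta delta lambda : R) (c : nat -> C)
    (n : nat) : C :=
  match n with
  | 0%nat => RtoC 0
  | 1%nat => RtoC 1
  | _ => (RtoC (Upsilon alpha beta lambda k n * Cbin delta n) * c n)%C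
  end.

(* [F] is the function D^k_{alpha,beta,delta,lambda} h on [U]. *)
Definition D_image (k : nat) (alpha beta delta lambda : R) (h F : C -> C)
    : Prop :=
  exists c : nat -> C,
    class_A h c /\
    forall z : C, U z -> C_psum (D_coef k alpha beta delta lambda c) z (F z).

Definition Cexp (z : C) : C := (exp (Re z) * cos (Im z), exp (Re z) * sin (Im z)).

(* [P] is the analytic branch on [U] of (F(z)/z)^s equal to 1 at 0: near 0 it is
   exp (s * log (F(z)/z)), with log (F(z)/z) the analytic logarithm [L] vanishing
   at 0, and it is analytic in all of [U].  Prescribing the germ at 0 rather
   than a logarithm on [U] keeps the cases in which the power makes sense although
   F(z)/z has zeros in [U], e.g. s = 0. *)
Definition power_branch (s : R) (F P : C -> C) : Prop :=
  analytic_in U P /\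
  exists (r : posreal) (L : C -> C),
    analytic_in (disc r) L /\ L (RtoC 0) = RtoC 0 /\
    forall z : C, disc r z ->
      F z = (z * Cexp (L z))%C /\ P z = Cexp (RtoC s * L z)%C.

(* z^{1-gamma} F'(z) / F(z)^{1-gamma} is subordinate to [phi]. *)
Definition power_quotient_subordinate (gamma : R) (F phi : C -> C) : Prop :=
  exists P : C -> C,
    power_branch (gamma - 1) F P /\
    subordinate (fun z => (C_derive F z * P z)%C) phi.

Definition class_B (k : nat) (alpha beta delta lambda gamma : R)
    (phi f : C -> C) : Prop :=
  bi_univalent f /\
  exists g Df Dg : C -> C,
    extended_inverse f g /\
    D_image k alpha beta delta lambda f Df /\
    D_image k alpha beta delta lambda g Dg /\
    power_quotient_subordinate gamma Df phi /\
    power_quotient_subordinate gamma Dg phi.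

(* Main.v *)
Require Import Defs.
From Stdlib Require Import Reals Lra Lia Psatz Classical ClassicalEpsilon.
From Coquelicot Require Import Coquelicot.
Open Scope R_scope.

(** Write [u], [v] for the Schwarz functions of the two subordinations.  Comparing
    the coefficients of [z] and [z^2] gives, with [T_n = Upsilon_n^k C(delta, n)],
    (gamma+1) T2 a2 = B1 u1 and
    (gamma+2) T3 a3 + (gamma-1)(gamma+2)/2 T2^2 a2^2 = B1 u2 + B2 u1^2, and the
    same relations for [v] with (a2, a3) replaced by (-a2, 2 a2^2 - a3), the
    coefficients of the inverse.  Hence v1 = -u1,
    E a2^2 = B1^3 (u2 + v2 + 2 u1^2), and
    2 (gamma+2) T3 (a3 - a2^2) = B1 (u2 - v2), so everything follows from
    |u2| + |u1|^2 <= 1.  Analyticity being local, that inequality is deduced from a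
    maximum principle which needs only third-order Taylor expansions at each
    point.  The sign of T3 comes from the convergence of Euler's integral. *)

(** * Third-order jets at 0 *)

(** Order 3 is forced by the derivative: the coefficients of z and z^2 in F'(z) (F(z)/z)^(gamma-1)
    involve F up to z^3. Jets are error estimates rather than power series because sums, products,
    compositions and quotients of estimates need only elementary inequalities, with no rearrangement
    of series and no proof that a Moebius transform of a Schwarz function is analytic. The price is
    that neither the mean value property on circles nor removable singularities are at hand; the
    maximum principle therefore compares a value with four nearby ones, and quotients by z are
    multiplied out or given enough zeros at 0.

    The two conditions in the conclusion come from its denominators. For E = 0 the bound for a2 has
    no meaning. T3 can vanish or be negative for some parameters with alpha + beta <= 1, where the
    first summand of the bound for a3 is no positive quantity; hence the condition on Upsilon_3. E
    is complex because B2 may be. *)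

Definition bigO (n : nat) (F : C -> C) : Prop :=
  exists K r : R, 0 <= K /\ 0 < r <= 1 /\
    forall z : C, Cmod z < r -> Cmod (F z) <= K * Cmod z ^ n.

(** Restores the normalisation 0 <= K and r <= 1 from arbitrary K and r > 0. The former lets bounds
    be multiplied, the latter makes higher orders imply lower ones in [bigO_le]. *)
Lemma bigO_intro (n : nat) (F : C -> C) (K r : R) :
  0 < r -> (forall z, Cmod z < r -> Cmod (F z) <= K * Cmod z ^ n) -> bigO n F.
Proof.
  intros Hr H. exists (Rmax K 0), (Rmin r 1).
  split; [apply Rmax_r|]. split.
  - split; [apply Rmin_pos; lra | apply Rmin_r].
  - intros z Hz.
    apply Rle_trans with (K * Cmod z ^ n).
    + apply H. eapply Rlt_le_trans; [exact Hz | apply Rmin_l].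
    + apply Rmult_le_compat_r; [apply pow_le, Cmod_ge_0 | apply Rmax_l].
Qed.

Lemma bigO_ext_loc (n : nat) (F G : C -> C) (r : R) :
  0 < r -> (forall z, Cmod z < r -> F z = G z) -> bigO n F -> bigO n G.
Proof.
  intros Hr H (K & s & HK & Hs & HF).
  apply (bigO_intro n G K (Rmin r s)); [apply Rmin_pos; lra|].
  intros z Hz. rewrite <- H.
  - apply HF. eapply Rlt_le_trans; [exact Hz | apply Rmin_r].
  - eapply Rlt_le_trans; [exact Hz | apply Rmin_l].
Qed.

Lemma bigO_ext (n : nat) (F G : C -> C) :
  (forall z, F z = G z) -> bigO n F -> bigO n G.
Proof. intros H. apply (bigO_ext_loc n F G 1); [lra | auto]. Qed.

Lemma bigO_add (n : nat) (F G : C -> C) :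
  bigO n F -> bigO n G -> bigO n (fun z => F z + G z)%C.
Proof.
  intros (K & r & HK & Hr & HF) (L & s & HL & Hs & HG).
  apply (bigO_intro n _ (K + L) (Rmin r s)); [apply Rmin_pos; lra|].
  intros z Hz.
  eapply Rle_trans; [apply Cmod_triangle|]. rewrite Rmult_plus_distr_r.
  apply Rplus_le_compat.
  - apply HF. eapply Rlt_le_trans; [exact Hz | apply Rmin_l].
  - apply HG. eapply Rlt_le_trans; [exact Hz | apply Rmin_r].
Qed.

Lemma bigO_mul (n m : nat) (F G : C -> C) :
  bigO n F -> bigO m G -> bigO (n + m) (fun z => F z * G z)%C.
Proof.
  intros (K & r & HK & Hr & HF) (L & s & HL & Hs & HG).
  apply (bigO_intro _ _ (K * L) (Rmin r s)); [apply Rmin_pos; lra|].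
  intros z Hz. rewrite Cmod_mult, pow_add.
  replace (K * L * (Cmod z ^ n * Cmod z ^ m))
    with ((K * Cmod z ^ n) * (L * Cmod z ^ m)) by ring.
  apply Rmult_le_compat; try apply Cmod_ge_0.
  - apply HF. eapply Rlt_le_trans; [exact Hz | apply Rmin_l].
  - apply HG. eapply Rlt_le_trans; [exact Hz | apply Rmin_r].
Qed.

Lemma bigO_const (c : C) : bigO 0 (fun _ => c).
Proof. apply (bigO_intro _ _ (Cmod c) 1); [lra|]. intros; simpl; lra. Qed.

Lemma bigO_id : bigO 1 (fun z => z).
Proof. apply (bigO_intro _ _ 1 1); [lra|]. intros; simpl; lra. Qed.

Lemma bigO_le (n m : nat) (F : C -> C) : (m <= n)%nat -> bigO n F -> bigO m F.
Proof.
  intros Hmn (K & r & HK & Hr & HF).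
  exists K, r. do 2 (split; [assumption|]). intros z Hz.
  eapply Rle_trans; [apply HF, Hz|]. apply Rmult_le_compat_l; [assumption|].
  replace n with (m + (n - m))%nat by lia. rewrite pow_add.
  rewrite <- (Rmult_1_r (Cmod z ^ m)) at 2.
  apply Rmult_le_compat_l; [apply pow_le, Cmod_ge_0|].
  rewrite <- (pow1 (n - m)). apply pow_incr. split; [apply Cmod_ge_0 | lra].
Qed.

Lemma bigO_scal (n : nat) (c : C) (F : C -> C) :
  bigO n F -> bigO n (fun z => c * F z)%C.
Proof. exact (bigO_mul 0 n (fun _ => c) F (bigO_const c)). Qed.

Lemma bigO_zmul (n : nat) (F : C -> C) :
  bigO n F -> bigO (S n) (fun z => z * F z)%C.
Proof. exact (bigO_mul 1 n (fun z => z) F bigO_id). Qed.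

Lemma bigO_sub (n : nat) (F G : C -> C) :
  bigO n F -> bigO n G -> bigO n (fun z => F z - G z)%C.
Proof.
  intros HF HG.
  apply (bigO_ext n (fun z => F z + (-(1)) * G z)%C); [intros; ring|].
  apply bigO_add; [assumption|]. now apply bigO_scal.
Qed.

Lemma bigO_comp (n : nat) (F w : C -> C) :
  bigO n F -> bigO 1 w -> bigO n (fun z => F (w z)).
Proof.
  intros (K & r & HK & Hr & HF) (L & s & HL & Hs & HG).
  assert (Hq : 0 < r / (L + 1)) by (apply Rdiv_lt_0_compat; lra).
  apply (bigO_intro _ _ (K * L ^ n) (Rmin s (r / (L + 1)))).
  - apply Rmin_pos; lra.
  - intros z Hz.
    assert (Hzs : Cmod z < s) by (eapply Rlt_le_trans; [exact Hz | apply Rmin_l]).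
    assert (Hzr : Cmod z < r / (L + 1))
      by (eapply Rlt_le_trans; [exact Hz | apply Rmin_r]).
    specialize (HG z Hzs). rewrite pow_1 in HG.
    assert (Hz0 := Cmod_ge_0 z).
    assert (Hlt : Cmod z * (L + 1) < r).
    { replace r with (r / (L + 1) * (L + 1)) by (field; lra).
      apply Rmult_lt_compat_r; lra. }
    eapply Rle_trans; [apply HF; nra|].
    rewrite Rmult_assoc, <- Rpow_mult_distr.
    apply Rmult_le_compat_l; [assumption|].
    apply pow_incr. split; [apply Cmod_ge_0 | assumption].
Qed.

Lemma bigO_val0 (n : nat) (F : C -> C) : bigO (S n) F -> F 0 = 0.
Proof.
  intros (K & r & HK & Hr & HF). apply Cmod_eq_0.
  specialize (HF 0%C). rewrite Cmod_0, pow_ne_zero in HF by lia.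
  assert (H := Cmod_ge_0 (F 0)). lra.
Qed.

Lemma bigO_small (F : C -> C) (e : R) :
  0 < e -> bigO 1 F ->
  exists d : R, 0 < d /\ forall z, Cmod z < d -> Cmod (F z) < e.
Proof.
  intros He (K & r & HK & Hr & HF).
  exists (Rmin r (e / (K + 1))). split.
  - apply Rmin_pos; [lra|]. apply Rdiv_lt_0_compat; lra.
  - intros z Hz.
    assert (Hzs : Cmod z < r) by (eapply Rlt_le_trans; [exact Hz | apply Rmin_l]).
    assert (Hzr : Cmod z < e / (K + 1))
      by (eapply Rlt_le_trans; [exact Hz | apply Rmin_r]).
    specialize (HF z Hzs). rewrite pow_1 in HF.
    assert (Hz0 := Cmod_ge_0 z).
    assert (Hlt : Cmod z * (K + 1) < e).
    { replace e with (e / (K + 1) * (K + 1)) by (field; lra).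
      apply Rmult_lt_compat_r; lra. }
    nra.
Qed.

Lemma Cmod_le_small_eq0 (c : C) (K r : R) :
  0 < r -> (forall t, 0 < t < r -> Cmod c <= K * t) -> c = 0.
Proof.
  intros Hr H. apply Cmod_eq_0. assert (Hc := Cmod_ge_0 c).
  destruct (Req_dec (Cmod c) 0) as [|Hne]; [assumption|exfalso].
  assert (HK : 0 <= Rabs K) by apply Rabs_pos.
  (* For this t, |K| t stays below |c| / 2. *)
  set (t := Rmin (r / 2) (Cmod c / (2 * (Rabs K + 1)))).
  assert (Hq : 0 < Cmod c / (2 * (Rabs K + 1))) by (apply Rdiv_lt_0_compat; lra).
  assert (Ht : 0 < t) by (apply Rmin_pos; lra).
  assert (Ht1 : t <= r / 2) by apply Rmin_l.
  assert (Ht2 : t <= Cmod c / (2 * (Rabs K + 1))) by apply Rmin_r.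
  assert (Ht3 : t * (2 * (Rabs K + 1)) <= Cmod c).
  { replace (Cmod c) with (Cmod c / (2 * (Rabs K + 1)) * (2 * (Rabs K + 1)))
      by (field; lra).
    apply Rmult_le_compat_r; lra. }
  specialize (H t ltac:(lra)). assert (HKK := Rle_abs K). nra.
Qed.

(** Testing positive real arguments t is enough: after division by t, |c| is at most a constant
    times t. *)
Lemma bigO_zmul_const (n : nat) (c : C) (F : C -> C) :
  bigO 1 F -> bigO (S (S n)) (fun z => z * (c + F z))%C -> c = 0.
Proof.
  intros (K & r & HK & Hr & HF) HG.
  apply (bigO_le _ 2) in HG; [|lia].
  destruct HG as (L & s & HL & Hs & HG).
  apply (Cmod_le_small_eq0 c (K + L) (Rmin r s)); [apply Rmin_pos; lra|].
  intros t [Ht0 Ht].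
  assert (Hm : Cmod (RtoC t) = t) by (rewrite Cmod_R; apply Rabs_pos_eq; lra).
  assert (Htr : t < r) by (eapply Rlt_le_trans; [exact Ht | apply Rmin_l]).
  assert (Hts : t < s) by (eapply Rlt_le_trans; [exact Ht | apply Rmin_r]).
  specialize (HF t ltac:(lra)). specialize (HG t ltac:(lra)).
  rewrite Cmod_mult, Hm in HG. rewrite Hm, pow_1 in HF.
  assert (HG' : Cmod (c + F t) <= L * t).
  { apply (Rmult_le_reg_l t); [assumption|]. simpl in HG. lra. }
  replace c with ((c + F t) + - F t)%C by ring.
  eapply Rle_trans; [apply Cmod_triangle|]. rewrite Cmod_opp. lra.
Qed.

Definition cubic (c0 c1 c2 c3 z : C) : C :=
  (c0 + z * (c1 + z * (c2 + z * c3)))%C.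

Definition jet (F : C -> C) (c0 c1 c2 c3 : C) : Prop :=
  bigO 4 (fun z => F z - cubic c0 c1 c2 c3 z)%C.

Lemma jet_ext_loc (F G : C -> C) (c0 c1 c2 c3 : C) (r : R) :
  0 < r -> (forall z, Cmod z < r -> F z = G z) ->
  jet F c0 c1 c2 c3 -> jet G c0 c1 c2 c3.
Proof.
  intros Hr H. apply (bigO_ext_loc _ _ _ r); [assumption|].
  intros z Hz. now rewrite H.
Qed.

Lemma jet_bounded (F : C -> C) (c0 c1 c2 c3 : C) :
  jet F c0 c1 c2 c3 -> bigO 0 F.
Proof.
  intros H.
  apply (bigO_ext _ (fun z => (F z - cubic c0 c1 c2 c3 z) + cubic c0 c1 c2 c3 z)%C);
    [intros; ring|].
  apply bigO_add; [apply (bigO_le 4); [lia | exact H]|].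
  unfold cubic.
  repeat first [apply bigO_const | apply bigO_add
               | apply (bigO_le 1); [lia|]; apply bigO_zmul].
Qed.

Lemma jet_bigO1 (F : C -> C) (c0 c1 c2 c3 : C) :
  jet F c0 c1 c2 c3 -> bigO 1 (fun z => F z - c0)%C.
Proof.
  intros H.
  apply (bigO_ext _ (fun z => (F z - cubic c0 c1 c2 c3 z)
                              + z * (c1 + z * (c2 + z * c3)))%C);
    [intros; unfold cubic; ring|].
  apply bigO_add; [apply (bigO_le 4); [lia | exact H]|].
  apply bigO_zmul.
  repeat first [apply bigO_const | apply bigO_add
               | apply (bigO_le 1); [lia|]; apply bigO_zmul].
Qed.

Lemma jet_val0 (F : C -> C) (c0 c1 c2 c3 : C) :
  jet F c0 c1 c2 c3 -> F 0 = c0.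
Proof.
  intros H. apply jet_bigO1, bigO_val0 in H.
  replace (F 0) with ((F 0 - c0) + c0)%C by ring. rewrite H. ring.
Qed.

Lemma jet_zero (c0 c1 c2 c3 : C) :
  bigO 4 (cubic c0 c1 c2 c3) -> c0 = 0 /\ c1 = 0 /\ c2 = 0 /\ c3 = 0.
Proof.
  unfold cubic. intros H.
  assert (H0 : c0 = 0).
  { apply bigO_val0 in H. rewrite <- H. ring. }
  subst c0.
  assert (H1 : c1 = 0).
  { apply (bigO_zmul_const 0 c1 (fun z => z * (c2 + z * c3))%C).
    - apply bigO_zmul, bigO_add; [apply bigO_const|].
      apply (bigO_le 1); [lia|]. apply bigO_zmul, bigO_const.
    - apply (bigO_le 4); [lia|]. revert H. apply bigO_ext. intros; ring. }
  subst c1.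
  (* A factor z cancels away from 0 only; the product says nothing about F at 0, so that value is
     asked for separately. *)
  assert (Hsq : forall F n, bigO (S n) (fun z => z * F z)%C -> F 0 = 0 -> bigO n F).
  { intros F n (K & r & HK & Hr & HF) HF0.
    apply (bigO_intro _ _ K r); [lra|]. intros z Hz.
    destruct (Ceq_dec z 0) as [->|Hz0].
    - rewrite HF0, Cmod_0. apply Rmult_le_pos; [assumption|]. apply pow_le; lra.
    - apply (Rmult_le_reg_l (Cmod z)); [now apply Cmod_gt_0|].
      rewrite <- Cmod_mult. specialize (HF z Hz). simpl in HF. lra. }
  assert (H' : bigO 3 (fun z => z * (c2 + z * c3))%C).
  { apply Hsq; [|ring]. revert H. apply bigO_ext. intros; ring. }
  assert (H2 : c2 = 0).
  { apply (bigO_zmul_const 0 c2 (fun z => z * c3)%C).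
    - apply bigO_zmul, bigO_const.
    - now apply (bigO_le 3); [lia|]. }
  subst c2.
  assert (H'' : bigO 2 (fun z => z * c3)%C).
  { apply Hsq; [|ring]. revert H'. apply bigO_ext. intros; ring. }
  assert (H3 : c3 = 0).
  { apply (bigO_zmul_const 0 c3 (fun _ => 0)%C).
    - apply (bigO_ext _ (fun z => z * 0)%C); [intros; ring|].
      apply bigO_zmul, bigO_const.
    - revert H''. apply bigO_ext. intros; ring. }
  auto.
Qed.

Lemma jet_unique (F : C -> C) (c0 c1 c2 c3 d0 d1 d2 d3 : C) :
  jet F c0 c1 c2 c3 -> jet F d0 d1 d2 d3 ->
  c0 = d0 /\ c1 = d1 /\ c2 = d2 /\ c3 = d3.
Proof.
  intros H H'.
  destruct (jet_zero (c0 - d0) (c1 - d1) (c2 - d2) (c3 - d3)) as (E0 & E1 & E2 & E3).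
  - generalize (bigO_sub _ _ _ H' H). apply bigO_ext. intros; unfold cubic; ring.
  - assert (Hs : forall x y : C, (x - y = 0 -> x = y)%C).
    { intros x y E. replace x with ((x - y) + y)%C by ring. rewrite E. ring. }
    auto.
Qed.

Lemma jet_const (c : C) : jet (fun _ => c) c 0 0 0.
Proof.
  apply (bigO_ext _ (fun z => z * (z * (z * (z * 0))))%C);
    [intros; unfold cubic; ring|].
  do 4 apply bigO_zmul. apply bigO_const.
Qed.

Lemma jet_id : jet (fun z => z) 0 1 0 0.
Proof.
  apply (bigO_ext _ (fun z => z * (z * (z * (z * 0))))%C);
    [intros; unfold cubic; ring|].
  do 4 apply bigO_zmul. apply bigO_const.
Qed.

Lemma jet_add (F G : C -> C) (c0 c1 c2 c3 d0 d1 d2 d3 : C) :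
  jet F c0 c1 c2 c3 -> jet G d0 d1 d2 d3 ->
  jet (fun z => F z + G z)%C (c0 + d0) (c1 + d1) (c2 + d2) (c3 + d3).
Proof.
  intros HF HG. generalize (bigO_add _ _ _ HF HG). apply bigO_ext.
  intros; unfold cubic; ring.
Qed.

Lemma jet_mul (F G : C -> C) (c0 c1 c2 c3 d0 d1 d2 d3 : C) :
  jet F c0 c1 c2 c3 -> jet G d0 d1 d2 d3 ->
  jet (fun z => F z * G z)%C (c0 * d0) (c0 * d1 + c1 * d0)
    (c0 * d2 + c1 * d1 + c2 * d0) (c0 * d3 + c1 * d2 + c2 * d1 + c3 * d0).
Proof.
  intros HF HG.
  (* The last summand collects the terms of degree 4 to 6 in the product of the two cubics. *)
  apply (bigO_ext _ (fun z =>
    F z * (G z - cubic d0 d1 d2 d3 z) + (F z - cubic c0 c1 c2 c3 z) * cubic d0 d1 d2 d3 z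
    + z * (z * (z * (z * ((c1 * d3 + c2 * d2 + c3 * d1)
                          + z * ((c2 * d3 + c3 * d2) + z * (c3 * d3)))))))%C);
    [intros; unfold cubic; ring|].
  apply bigO_add; [apply bigO_add|].
  - exact (bigO_mul 0 4 _ _ (jet_bounded _ _ _ _ _ HF) HG).
  - apply (bigO_mul 4 0); [exact HF|]. unfold cubic.
    repeat first [apply bigO_const | apply bigO_add
                 | apply (bigO_le 1); [lia|]; apply bigO_zmul].
  - do 4 apply bigO_zmul.
    repeat first [apply bigO_const | apply bigO_add
                 | apply (bigO_le 1); [lia|]; apply bigO_zmul].
Qed.

Lemma jet_eq (F : C -> C) (c0 c1 c2 c3 d0 d1 d2 d3 : C) :
  c0 = d0 -> c1 = d1 -> c2 = d2 -> c3 = d3 ->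
  jet F c0 c1 c2 c3 -> jet F d0 d1 d2 d3.
Proof. now intros -> -> -> ->. Qed.

Lemma jet_scal (c : C) (F : C -> C) (c0 c1 c2 c3 : C) :
  jet F c0 c1 c2 c3 -> jet (fun z => c * F z)%C (c * c0) (c * c1) (c * c2) (c * c3).
Proof.
  intros HF. generalize (jet_mul _ _ _ _ _ _ _ _ _ _ (jet_const c) HF).
  apply jet_eq; ring.
Qed.

(** With p the cubic of F, F(w) - p(w) = O(w^4) = O(z^4) because w = O(z), and p(w) is expanded in
    Horner form by the sum and product rules. *)
Lemma jet_comp (F w : C -> C) (c0 c1 c2 c3 w1 w2 w3 : C) :
  jet F c0 c1 c2 c3 -> jet w 0 w1 w2 w3 ->
  jet (fun z => F (w z)) c0 (c1 * w1) (c1 * w2 + c2 * (w1 * w1))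
    (c1 * w3 + c2 * (2 * (w1 * w2)) + c3 * (w1 * w1 * w1)).
Proof.
  intros HF Hw.
  assert (Hw1 : bigO 1 w).
  { generalize (jet_bigO1 _ _ _ _ _ Hw). apply bigO_ext. intros; ring. }
  assert (Hp : jet (fun z => cubic c0 c1 c2 c3 (w z)) c0 (c1 * w1)
    (c1 * w2 + c2 * (w1 * w1))
    (c1 * w3 + c2 * (2 * (w1 * w2)) + c3 * (w1 * w1 * w1))).
  { assert (HJ := jet_add _ _ _ _ _ _ _ _ _ _ (jet_const c0)
      (jet_mul _ _ _ _ _ _ _ _ _ _ Hw
        (jet_add _ _ _ _ _ _ _ _ _ _ (jet_const c1)
          (jet_mul _ _ _ _ _ _ _ _ _ _ Hw
            (jet_add _ _ _ _ _ _ _ _ _ _ (jet_const c2)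
              (jet_mul _ _ _ _ _ _ _ _ _ _ Hw (jet_const c3))))))).
    revert HJ. apply jet_eq; ring. }
  generalize (bigO_add _ _ _ (bigO_comp _ _ _ HF Hw1) Hp).
  apply bigO_ext. intros; ring.
Qed.

(** The d_i are the recursive solution of F p = 1 + O(z^4) for a cubic p; then 1/F - p = (1 - F p) /
    F, and 1/F is bounded near 0 since |F| >= |c0| / 2 there. *)
Lemma jet_inv (F : C -> C) (c0 c1 c2 c3 : C) :
  c0 <> 0 -> jet F c0 c1 c2 c3 ->
  exists d0 d1 d2 d3 : C, jet (fun z => / F z)%C d0 d1 d2 d3.
Proof.
  intros Hc HF.
  destruct (bigO_small _ (Cmod c0 / 2) ltac:(apply Cmod_gt_0 in Hc; lra)
    (jet_bigO1 _ _ _ _ _ HF)) as (r & Hr & Hsm).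
  assert (Hlow : forall z, Cmod z < r -> Cmod c0 / 2 <= Cmod (F z)).
  { intros z Hz. specialize (Hsm z Hz).
    assert (Ht := Cmod_triangle (F z) (- (F z - c0))).
    replace (F z + - (F z - c0))%C with c0 in Ht by ring.
    rewrite Cmod_opp in Ht. lra. }
  assert (Hpos : 0 < Cmod c0) by now apply Cmod_gt_0.
  set (d0 := (/ c0)%C).
  set (d1 := (- d0 * (c1 * d0))%C).
  set (d2 := (- d0 * (c1 * d1 + c2 * d0))%C).
  set (d3 := (- d0 * (c1 * d2 + c2 * d1 + c3 * d0))%C).
  exists d0, d1, d2, d3.
  assert (Hp : jet (cubic d0 d1 d2 d3) d0 d1 d2 d3).
  { generalize (jet_const 0). apply bigO_ext. intros; unfold cubic; ring. }
  assert (H1 : bigO 4 (fun z => 1 - F z * cubic d0 d1 d2 d3 z)%C).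
  { assert (HM := jet_mul _ _ _ _ _ _ _ _ _ _ HF Hp).
    apply (jet_eq _ _ _ _ _ 1 0 0 0) in HM.
    - generalize (bigO_scal _ (-(1)) _ HM). apply bigO_ext.
      intros; unfold cubic; ring.
    - unfold d0; now field.
    - unfold d1, d0; now field.
    - unfold d2, d1, d0; now field.
    - unfold d3, d2, d1, d0; now field. }
  assert (H2 : bigO 0 (fun z => / F z)%C).
  { apply (bigO_intro _ _ (2 / Cmod c0) r); [assumption|].
    intros z Hz. specialize (Hlow z Hz).
    rewrite Cmod_inv by (apply Cmod_gt_0; lra). simpl. rewrite Rmult_1_r.
    replace (2 / Cmod c0) with (/ (Cmod c0 / 2)) by (field; lra).
    apply Rinv_le_contravar; lra. }
  generalize (bigO_mul 4 0 _ _ H1 H2). apply (bigO_ext_loc _ _ _ r); [assumption|].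
  intros z Hz. specialize (Hlow z Hz).
  assert (F z <> 0) by (apply Cmod_gt_0; lra). now field.
Qed.

(** * Maximum principle and the Schwarz inequalities *)

Lemma Cmod_le_Rabs (z : C) : Cmod z <= Rabs (fst z) + Rabs (snd z).
Proof.
  destruct z as [x y]; simpl.
  replace (x, y) with (RtoC x + Ci * RtoC y)%C
    by (unfold Cplus, Cmult, Ci, RtoC; simpl; f_equal; ring).
  eapply Rle_trans; [apply Cmod_triangle|].
  rewrite Cmod_mult, Cmod_Ci, !Cmod_R. lra.
Qed.

(* The radius doubles as the parameter of [P]: this yields both a bound [1 / d]
   and a gap [S - d] below a supremum that is not attained. *)
Lemma closed_disc_uniform (rho : R) (P : C -> R -> Prop) :
  (forall z d d', P z d -> d' <= d -> P z d') ->
  (forall z, Cmod z <= rho ->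
     exists d, 0 < d /\ forall z', Cmod (z' - z) < d -> P z' d) ->
  exists d, 0 < d /\ forall z, Cmod z <= rho -> P z d.
Proof.
  intros Pmono Ploc.
  assert (Hd : forall u v : R, exists d : posreal,
    forall z', Cmod z' <= rho -> Rabs (fst z' - u) < d -> Rabs (snd z' - v) < d ->
      P z' d).
  { intros u v. destruct (Rle_or_lt (Cmod (u, v)) rho) as [Hin|Hout].
    - destruct (Ploc _ Hin) as (d & Hd & Hz).
      assert (Hd2 : 0 < d / 2) by lra.
      exists (mkposreal _ Hd2). simpl. intros z' _ H1 H2.
      apply (Pmono _ d); [|lra]. apply Hz.
      eapply Rle_lt_trans; [apply Cmod_le_Rabs|]. simpl.
      unfold Rminus in *. lra.
    (* The compactness theorem covers a square, so centres outside the disc also need a gauge: here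
       one so small that the box around the centre misses the disc. *)
    - assert (Hd2 : 0 < (Cmod (u, v) - rho) / 2) by lra.
      exists (mkposreal _ Hd2). simpl. intros z' Hz' H1 H2. exfalso.
      assert (Hm := Cmod_le_Rabs ((u, v) - z')). simpl in Hm.
      set (w := (u, v) : C) in *.
      assert (Ht := Cmod_triangle z' (w - z')).
      replace (z' + (w - z'))%C with w in Ht by ring.
      rewrite <- Rabs_Ropp in H1, H2.
      replace (- (fst z' - u)) with (u + - fst z') in H1 by ring.
      replace (- (snd z' - v)) with (v + - snd z') in H2 by ring.
      lra. }
  set (delta := fun u v => proj1_sig (constructive_indefinite_description _ (Hd u v))).
  assert (Hdelta : forall u v z', Cmod z' <= rho -> Rabs (fst z' - u) < delta u v ->
    Rabs (snd z' - v) < delta u v -> P z' (delta u v)).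
  { intros u v. unfold delta.
    exact (proj2_sig (constructive_indefinite_description _ (Hd u v))). }
  destruct (compactness_value_2d (- rho) rho (- rho) rho delta) as [d Hc].
  exists d. split; [apply cond_pos|]. intros z Hz.
  assert (Hm := Rmax_Cmod z).
  assert (H1 := Rmax_l (Rabs (fst z)) (Rabs (snd z))).
  assert (H2 := Rmax_r (Rabs (fst z)) (Rabs (snd z))).
  apply NNPP. intros Hn.
  apply (Hc (fst z) (snd z)).
  - apply Rabs_le_between. lra.
  - apply Rabs_le_between. lra.
  - intros (u & v & _ & _ & Hu & Hv & Hle). apply Hn.
    apply (Pmono _ (delta u v)); [|assumption]. now apply Hdelta.
Qed.

(** Upper semicontinuity bounds u on the compact disc and makes it attain its supremum; the second
    hypothesis forbids attaining it inside, so it is attained on the circle. *)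
Lemma max_principle (u : C -> R) (rho M : R) :
  0 < rho ->
  (forall z, Cmod z <= rho -> forall e, 0 < e ->
     exists d, 0 < d /\ forall z', Cmod (z' - z) < d -> u z' < u z + e) ->
  (forall z, Cmod z < rho -> exists z', Cmod z' <= rho /\ u z < u z') ->
  (forall z, Cmod z = rho -> u z <= M) ->
  forall z, Cmod z <= rho -> u z <= M.
Proof.
  intros Hrho Husc Hnomax Hbd.
  assert (Hmax : exists z0, Cmod z0 <= rho /\ forall z, Cmod z <= rho -> u z <= u z0).
  (* The alternative d <= 0 keeps the predicate monotone where 1 / d is no longer a growing
     bound. *)
  { destruct (closed_disc_uniform rho (fun z d => u z <= / d /\ 0 < d \/ d <= 0))
      as (b & Hb & Hbb).
    - intros z d d' [[H Hd]|H] Hle; [|right; lra].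
      destruct (Rle_or_lt d' 0) as [|Hd']; [now right|left].
      split; [|assumption]. eapply Rle_trans; [exact H|].
      apply Rinv_le_contravar; lra.
    - intros z Hz. destruct (Husc z Hz 1 ltac:(lra)) as (d & Hd & H).
      assert (Hq : 0 < / (Rabs (u z) + 1))
        by (apply Rinv_0_lt_compat; assert (Ha := Rabs_pos (u z)); lra).
      exists (Rmin d (/ (Rabs (u z) + 1))). split; [now apply Rmin_pos|].
      intros z' Hz'. left. split; [|now apply Rmin_pos].
      apply Rle_trans with (Rabs (u z) + 1).
      + assert (Ha := Rle_abs (u z)).
        specialize (H z' ltac:(eapply Rlt_le_trans; [exact Hz' | apply Rmin_l])). lra.
      + rewrite <- (Rinv_inv (Rabs (u z) + 1)) at 1.
        apply Rinv_le_contravar; [now apply Rmin_pos | apply Rmin_r].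
    - destruct (completeness (fun x => exists z, Cmod z <= rho /\ x = u z))
        as [S [HSub HSlub]].
      + exists (/ b). intros x (z & Hz & ->). destruct (Hbb z Hz) as [[H _]|H]; lra.
      + exists (u 0), 0%C. rewrite Cmod_0. split; [lra | reflexivity].
      + apply NNPP. intros Hno.
        assert (Hlt : forall z, Cmod z <= rho -> u z < S).
        { intros z Hz. destruct (Rle_or_lt S (u z)) as [Hge|]; [exfalso|assumption].
          apply Hno. exists z. split; [assumption|]. intros z' Hz'.
          eapply Rle_trans; [|exact Hge]. apply HSub. now exists z'. }
        destruct (closed_disc_uniform rho (fun z d => u z <= S - d)) as (d & Hd & Hdd).
        * intros; lra.
        * intros z Hz. specialize (Hlt z Hz).
          destruct (Husc z Hz ((S - u z) / 2) ltac:(lra)) as (d & Hd & H).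
          exists (Rmin d ((S - u z) / 2)). split; [apply Rmin_pos; lra|].
          intros z' Hz'.
          specialize (H z' ltac:(eapply Rlt_le_trans; [exact Hz' | apply Rmin_l])).
          assert (Hr := Rmin_r d ((S - u z) / 2)). lra.
        * assert (S <= S - d); [|lra].
          apply HSlub. intros x (z & Hz & ->). now apply Hdd. }
  destruct Hmax as (z0 & Hz0 & Hm). intros z Hz.
  apply Rle_trans with (u z0); [now apply Hm|].
  destruct (Rle_lt_or_eq_dec _ _ Hz0) as [Hin|Hbdry].
  - exfalso. destruct (Hnomax z0 Hin) as (z' & Hz' & Hu).
    specialize (Hm z' Hz'). lra.
  - now apply Hbd.
Qed.

Definition has_jet (F : C -> C) (z0 : C) : Prop :=
  exists c0 c1 c2 c3 : C, jet (fun h => F (z0 + h)%C) c0 c1 c2 c3.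

Lemma has_jet_add (F G : C -> C) (z0 : C) :
  has_jet F z0 -> has_jet G z0 -> has_jet (fun z => F z + G z)%C z0.
Proof.
  intros (c0 & c1 & c2 & c3 & HF) (d0 & d1 & d2 & d3 & HG).
  do 4 eexists. exact (jet_add _ _ _ _ _ _ _ _ _ _ HF HG).
Qed.

Lemma has_jet_mul (F G : C -> C) (z0 : C) :
  has_jet F z0 -> has_jet G z0 -> has_jet (fun z => F z * G z)%C z0.
Proof.
  intros (c0 & c1 & c2 & c3 & HF) (d0 & d1 & d2 & d3 & HG).
  do 4 eexists. exact (jet_mul _ _ _ _ _ _ _ _ _ _ HF HG).
Qed.

Lemma has_jet_const (c z0 : C) : has_jet (fun _ => c) z0.
Proof. do 4 eexists. apply jet_const. Qed.

Lemma has_jet_id (z0 : C) : has_jet (fun z => z) z0.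
Proof.
  do 4 eexists. exact (jet_add _ _ _ _ _ _ _ _ _ _ (jet_const z0) jet_id).
Qed.

Lemma has_jet_inv (F : C -> C) (z0 : C) :
  F z0 <> 0 -> has_jet F z0 -> has_jet (fun z => / F z)%C z0.
Proof.
  intros H0 (c0 & c1 & c2 & c3 & HF).
  refine (jet_inv _ c0 c1 c2 c3 _ HF).
  apply jet_val0 in HF. rewrite Cplus_0_r in HF. now rewrite <- HF.
Qed.

Lemma has_jet_pow (F : C -> C) (z0 : C) (n : nat) :
  has_jet F z0 -> has_jet (fun z => F z ^ n)%C z0.
Proof.
  intros HF. induction n as [|n IH].
  - exact (has_jet_const 1 z0).
  - exact (has_jet_mul _ _ z0 HF IH).
Qed.

Lemma has_jet_continuous (F : C -> C) (z0 : C) :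
  has_jet F z0 -> forall e, 0 < e -> exists d, 0 < d /\
    forall z, Cmod (z - z0) < d -> Cmod (F z - F z0) < e.
Proof.
  intros (c0 & c1 & c2 & c3 & HF) e He.
  assert (H0 := jet_val0 _ _ _ _ _ HF). simpl in H0. rewrite Cplus_0_r in H0.
  destruct (bigO_small _ e He (jet_bigO1 _ _ _ _ _ HF)) as (d & Hd & H).
  exists d. split; [assumption|]. intros z Hz. specialize (H _ Hz).
  rewrite H0. now replace (z0 + (z - z0))%C with z in H by ring.
Qed.

Lemma Cmod_sq (z : C) : Cmod z ^ 2 = fst z ^ 2 + snd z ^ 2.
Proof. exact (Cmod2_alt z). Qed.

(* The average of [|F|^2] over the four points [z0 + i^j t] kills the terms of
   odd order and the [t^2]-term [Re (conj F(z0) F''(z0))], so it is at least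
   [|F z0|^2 - O(t^3)], while [e |z|^2] gains [e t^2]. *)
Lemma perturbed_modulus_not_max (F : C -> C) (z0 : C) (e r : R) :
  0 < e -> 0 < r -> has_jet F z0 ->
  exists z, Cmod (z - z0) < r /\
    Cmod (F z0) ^ 2 + e * Cmod z0 ^ 2 < Cmod (F z) ^ 2 + e * Cmod z ^ 2.
Proof.
  intros He Hr (c0 & c1 & c2 & c3 & HF).
  assert (H0 := jet_val0 _ _ _ _ _ HF). simpl in H0. rewrite Cplus_0_r in H0.
  assert (HE : bigO 3 (fun h => F (z0 + h)%C - (c0 + h * (c1 + h * c2)))%C).
  { apply (bigO_ext _ (fun h => (F (z0 + h)%C - cubic c0 c1 c2 c3 h)
                                + h * (h * (h * c3)))%C);
      [intros; unfold cubic; ring|].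
    apply bigO_add; [apply (bigO_le 4); [lia | exact HF]|].
    do 3 apply bigO_zmul. apply bigO_const. }
  destruct HE as (K & s & HK & Hs & HE).
  (* Bounds the quadratic part of the expansion for |h| <= 1, which holds as t < s <= 1. *)
  set (Pm := Cmod c0 + Cmod c1 + Cmod c2).
  assert (HPm : 0 <= Pm)
    by (assert (A0 := Cmod_ge_0 c0); assert (A1 := Cmod_ge_0 c1);
        assert (A2 := Cmod_ge_0 c2); unfold Pm; lra).
  assert (HPK : 0 <= Pm * K) by now apply Rmult_le_pos.
  (* Chosen so that t < q gives 2 Pm K t < e: the cubic error cannot eat up the gain e t^2. *)
  set (q := e / (2 * (Pm * K + 1))).
  assert (Hq : 0 < q) by (apply Rdiv_lt_0_compat; lra).
  set (t := Rmin (Rmin r s) q / 2).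
  assert (Hm : 0 < Rmin (Rmin r s) q) by (repeat apply Rmin_pos; lra).
  assert (Hm1 := Rmin_l (Rmin r s) q). assert (Hm2 := Rmin_r (Rmin r s) q).
  assert (Hm3 := Rmin_l r s). assert (Hm4 := Rmin_r r s).
  assert (Ht0 : 0 < t) by (unfold t; lra).
  assert (Htr : t < r) by (unfold t; lra).
  assert (Hts : t < s) by (unfold t; lra).
  assert (Htq : t < q) by (unfold t; lra).
  assert (Htq' : t * (2 * (Pm * K + 1)) < e).
  { replace e with (q * (2 * (Pm * K + 1))) by (unfold q; field; lra).
    apply Rmult_lt_compat_r; lra. }
  assert (Hpt : forall h, Cmod h = t ->
    Cmod (c0 + h * (c1 + h * c2)) ^ 2 - 2 * Pm * (K * t ^ 3) <= Cmod (F (z0 + h)%C) ^ 2).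
  { intros h Hh. specialize (HE h ltac:(lra)). rewrite Hh in HE.
    set (p := (c0 + h * (c1 + h * c2))%C) in *.
    assert (Hp : Cmod p <= Pm).
    { unfold p. eapply Rle_trans; [apply Cmod_triangle|]. rewrite Cmod_mult, Hh.
      assert (Ht := Cmod_triangle c1 (h * c2)). rewrite Cmod_mult, Hh in Ht.
      assert (A1 := Cmod_ge_0 c1). assert (A2 := Cmod_ge_0 c2).
      assert (A3 := Cmod_ge_0 (c1 + h * c2)).
      assert (B2 : t * Cmod c2 <= 1 * Cmod c2) by (apply Rmult_le_compat_r; lra).
      assert (B3 : t * Cmod (c1 + h * c2) <= 1 * Cmod (c1 + h * c2))
        by (apply Rmult_le_compat_r; lra).
      unfold Pm. lra. }
    assert (Ht := Cmod_triangle (F (z0 + h)%C) (- (F (z0 + h)%C - p))).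
    replace (F (z0 + h)%C + - (F (z0 + h)%C - p))%C with p in Ht by ring.
    rewrite Cmod_opp in Ht.
    assert (A := Cmod_ge_0 (F (z0 + h)%C)). assert (A' := Cmod_ge_0 p).
    assert (A'' := Cmod_ge_0 (F (z0 + h)%C - p)).
    assert (HX : Cmod p - K * t ^ 3 <= Cmod (F (z0 + h)%C)) by lra.
    revert Hp HX A A' HPm. assert (A3 := Rle_trans _ _ _ A'' HE). revert A3.
    generalize (Cmod p) (Cmod (F (z0 + h)%C)) (K * t ^ 3) Pm.
    clear. intros x y X P HX0 HxP Hxy Hy Hx HP.
    (* For X <= x one squares x - X <= y; otherwise x^2 - 2 P X is already nonpositive. *)
    destruct (Rle_or_lt X x); nra. }
  apply NNPP. intros Hno.
  assert (Hle : forall h, Cmod h = t ->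
    Cmod (F (z0 + h)%C) ^ 2 + e * Cmod (z0 + h) ^ 2 <= Cmod c0 ^ 2 + e * Cmod z0 ^ 2).
  { intros h Hh. apply Rnot_lt_le. intros Hlt. apply Hno. exists (z0 + h)%C.
    rewrite H0. split; [|assumption].
    replace (z0 + h - z0)%C with h by ring. lra. }
  assert (Hfour : forall h, Cmod h = t ->
    Cmod (c0 + h * (c1 + h * c2)) ^ 2 + e * Cmod (z0 + h) ^ 2
      <= Cmod c0 ^ 2 + e * Cmod z0 ^ 2 + 2 * Pm * (K * t ^ 3)).
  { intros h Hh. specialize (Hpt h Hh). specialize (Hle h Hh). lra. }
  clear Hpt Hle Hno.
  assert (P1 := Hfour (t, 0)). assert (P2 := Hfour (- t, 0)).
  assert (P3 := Hfour (0, t)). assert (P4 := Hfour (0, - t)).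
  assert (Hmod : forall x y, x ^ 2 + y ^ 2 = t ^ 2 -> Cmod (x, y) = t).
  { intros x y Hxy. unfold Cmod. simpl fst; simpl snd. rewrite Hxy.
    apply sqrt_pow2. lra. }
  specialize (P1 ltac:(apply Hmod; ring)). specialize (P2 ltac:(apply Hmod; ring)).
  specialize (P3 ltac:(apply Hmod; ring)). specialize (P4 ltac:(apply Hmod; ring)).
  rewrite !Cmod_sq in *.
  destruct c0 as [x0 y0], c1 as [x1 y1], c2 as [x2 y2], z0 as [x y].
  simpl fst in *; simpl snd in *.
  assert (Hsum : 4 * e * t ^ 2 <= 8 * Pm * (K * t ^ 3)).
  (* All cross terms cancel in the sum over the four points; beyond |c0|^2 only |c1|^2 t^2 + |c2|^2
     t^4 remains of the mean of the squared modulus. *)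
  { assert (Q1 : 0 <= (x1 ^ 2 + y1 ^ 2) * t ^ 2 + (x2 ^ 2 + y2 ^ 2) * t ^ 4) by nra.
    apply Rplus_le_reg_l with (4 * (x0 ^ 2 + y0 ^ 2 + e * (x ^ 2 + y ^ 2))
      + 4 * ((x1 ^ 2 + y1 ^ 2) * t ^ 2 + (x2 ^ 2 + y2 ^ 2) * t ^ 4)).
    lra. }
  assert (Ht2 : 0 < t ^ 2) by (apply pow_lt; lra).
  assert (e <= 2 * (Pm * K) * t); [|lra].
  apply (Rmult_le_reg_l (t ^ 2)); [assumption|]. simpl in *. lra.
Qed.

(** The maximum principle is applied to |F|^2 + e |z|^2. At 0 this function vanishes and is beaten
    by its value at rho, so only continuity is required of F there; this is what admits quotients by
    powers of z. *)
Lemma perturbed_modulus_bound (F : C -> C) (rho M e : R) :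
  0 < rho < 1 -> 0 < e -> 0 <= M ->
  F 0 = 0 ->
  (forall d, 0 < d -> exists r, 0 < r /\ forall z, Cmod z < r -> Cmod (F z) < d) ->
  (forall z, U z -> z <> 0 -> has_jet F z) ->
  (forall z, Cmod z = rho -> Cmod (F z) <= M) ->
  forall z, Cmod z <= rho -> Cmod (F z) ^ 2 <= M ^ 2 + e.
Proof.
  intros Hrho He HM HF0 Hcont0 HF Hbd z Hz.
  assert (Hcont : forall z, Cmod z <= rho -> forall d, 0 < d ->
    exists r, 0 < r /\ forall z', Cmod (z' - z) < r -> Cmod (F z' - F z) < d).
  { intros z1 Hz1 d Hd. destruct (Ceq_dec z1 0) as [->|Hn].
    - destruct (Hcont0 d Hd) as (r & Hr & H). exists r. split; [assumption|].
      intros z' Hz'. rewrite HF0.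
      replace (F z' - 0)%C with (F z') by ring. apply H.
      now replace z' with (z' - 0)%C by ring.
    - apply has_jet_continuous; [apply HF; [unfold U, Defs.disc; lra|]|]; assumption. }
  set (u := fun z => Cmod (F z) ^ 2 + e * Cmod z ^ 2).
  assert (Hu : u z <= M ^ 2 + e * rho ^ 2).
  { apply (max_principle u rho); [lra| | | |assumption].
    - intros z1 Hz1 d Hd.
      set (A := Cmod (F z1)). assert (HA : 0 <= A) by apply Cmod_ge_0.
      (* Since n <= 1, (A + n)^2 - A^2 <= n (2 A + 1) <= d / 2. *)
      set (n := Rmin 1 (d / (2 * (2 * A + 1)))).
      assert (Hq : 0 < d / (2 * (2 * A + 1))) by (apply Rdiv_lt_0_compat; lra).
      assert (Hn : 0 < n) by (apply Rmin_pos; lra).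
      assert (Hn1 : n <= 1) by apply Rmin_l.
      assert (Hn2 : n * (2 * (2 * A + 1)) <= d).
      { replace d with (d / (2 * (2 * A + 1)) * (2 * (2 * A + 1))) by (field; lra).
        apply Rmult_le_compat_r; [lra | apply Rmin_r]. }
      destruct (Hcont z1 Hz1 n Hn) as (r & Hr & H).
      (* The 3 comes from 2 |z1| s + s^2 <= 3 s, valid as |z1| <= 1 and s <= 1. *)
      set (s := Rmin 1 (d / (2 * (e * 3)))).
      assert (Hq' : 0 < d / (2 * (e * 3))) by (apply Rdiv_lt_0_compat; lra).
      assert (Hs : 0 < s) by (apply Rmin_pos; lra).
      assert (Hs1 : s <= 1) by apply Rmin_l.
      assert (Hs2 : s * (2 * (e * 3)) <= d).
      { replace d with (d / (2 * (e * 3)) * (2 * (e * 3))) by (field; lra).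
        apply Rmult_le_compat_r; [lra | apply Rmin_r]. }
      exists (Rmin r s). split; [now apply Rmin_pos|].
      intros z' Hz'.
      assert (Hz'r : Cmod (z' - z1) < r) by (eapply Rlt_le_trans; [exact Hz' | apply Rmin_l]).
      assert (Hz's : Cmod (z' - z1) < s) by (eapply Rlt_le_trans; [exact Hz' | apply Rmin_r]).
      specialize (H z' Hz'r).
      assert (T1 := Cmod_triangle (F z1) (F z' - F z1)).
      replace (F z1 + (F z' - F z1))%C with (F z') in T1 by ring.
      assert (T2 := Cmod_triangle z1 (z' - z1)).
      replace (z1 + (z' - z1))%C with z' in T2 by ring.
      assert (B1 := Cmod_ge_0 (F z')). assert (B2 := Cmod_ge_0 z').
      assert (B3 := Cmod_ge_0 z1).
      unfold u. fold A in T1 |- *.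
      assert (E1 : Cmod (F z') ^ 2 < A ^ 2 + d / 2).
      { apply Rlt_le_trans with ((A + n) ^ 2); nra. }
      assert (E2 : e * Cmod z' ^ 2 <= e * Cmod z1 ^ 2 + d / 2).
      { assert (Cmod z' ^ 2 <= Cmod z1 ^ 2 + 3 * s) by nra. nra. }
      lra.
    - intros z1 Hz1. destruct (Ceq_dec z1 0) as [->|Hn].
      + exists (RtoC rho). rewrite Cmod_R, Rabs_pos_eq by lra. split; [lra|].
        unfold u. rewrite HF0, Cmod_0, Cmod_R, Rabs_pos_eq by lra.
        assert (0 <= Cmod (F rho) ^ 2) by apply pow2_ge_0.
        assert (0 < rho ^ 2) by (apply pow_lt; lra). nra.
      + destruct (perturbed_modulus_not_max F z1 e (rho - Cmod z1)) as (z' & Hz' & H).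
        * assumption.
        * lra.
        * apply HF; [unfold U, Defs.disc; lra | assumption].
        * exists z'. split; [|exact H].
          assert (T := Cmod_triangle z1 (z' - z1)).
          replace (z1 + (z' - z1))%C with z' in T by ring. lra.
    - intros z1 Hz1. unfold u. rewrite Hz1. apply Rplus_le_compat_r.
      apply pow_incr. split; [apply Cmod_ge_0 | now apply Hbd]. }
  unfold u in Hu.
  assert (0 <= e * Cmod z ^ 2) by (apply Rmult_le_pos; [lra | apply pow2_ge_0]).
  assert (rho ^ 2 <= 1) by nra. nra.
Qed.

Lemma Rle_of_pow2_le (x y : R) : 0 <= x -> 0 <= y -> x ^ 2 <= y ^ 2 -> x <= y.
Proof. intros; nra. Qed.

Lemma maximum_modulus (F : C -> C) (rho M : R) :
  0 < rho < 1 -> 0 <= M ->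
  F 0 = 0 ->
  (forall d, 0 < d -> exists r, 0 < r /\ forall z, Cmod z < r -> Cmod (F z) < d) ->
  (forall z, U z -> z <> 0 -> has_jet F z) ->
  (forall z, Cmod z = rho -> Cmod (F z) <= M) ->
  forall z, Cmod z <= rho -> Cmod (F z) <= M.
Proof.
  intros Hrho HM HF0 Hc HF Hbd z Hz.
  apply Rle_of_pow2_le; [apply Cmod_ge_0 | assumption|].
  apply le_epsilon. intros e He.
  now apply (perturbed_modulus_bound F rho M e).
Qed.

Lemma Rle_of_small_error (x y K r : R) :
  0 < r -> (forall s, 0 < s < r -> x <= y + K * s) -> x <= y.
Proof.
  intros Hr H. apply le_epsilon. intros e He.
  assert (HK : 0 <= Rabs K) by apply Rabs_pos.
  set (s := Rmin (r / 2) (e / (Rabs K + 1))).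
  assert (Hq : 0 < e / (Rabs K + 1)) by (apply Rdiv_lt_0_compat; lra).
  assert (Hs : 0 < s) by (apply Rmin_pos; lra).
  assert (Hs1 : s <= r / 2) by apply Rmin_l.
  assert (Hs2 : s * (Rabs K + 1) <= e).
  { replace e with (e / (Rabs K + 1) * (Rabs K + 1)) by (field; lra).
    apply Rmult_le_compat_r; [lra | apply Rmin_r]. }
  specialize (H s ltac:(lra)). assert (HKK := Rle_abs K). nra.
Qed.

(* Applying the maximum principle to [F^(n+1) / z^n], which tends to 0 at 0,
   instead of [F / z] avoids removing the singularity; then [n] tends to infinity. *)
Lemma schwarz_lemma (F : C -> C) :
  (forall z, U z -> z <> 0 -> has_jet F z) -> bigO 1 F ->
  (forall z, U z -> Cmod (F z) <= 1) ->
  forall z, U z -> Cmod (F z) <= Cmod z.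
Proof.
  intros HF HO Hb z Hz.
  assert (HF0 : F 0 = 0) by exact (bigO_val0 0 F HO).
  destruct (Ceq_dec z 0) as [->|Hz0]; [rewrite HF0; lra|].
  assert (Hzpos : 0 < Cmod z) by now apply Cmod_gt_0.
  assert (Hz1 : Cmod z < 1) by exact Hz.
  assert (Key : forall n rho, Cmod z < rho < 1 ->
    Cmod (F z) ^ S n * rho ^ n <= Cmod z ^ n).
  { intros n rho Hrho.
    set (H := fun z : C => (F z ^ S n * / (z ^ n))%C).
    assert (Hmod : forall z : C, z <> 0 -> Cmod (H z) = Cmod (F z) ^ S n / Cmod z ^ n).
    { intros x Hx. unfold H. rewrite Cmod_mult, Cmod_pow, Cmod_inv, Cmod_pow;
        [reflexivity|].
      apply Cmod_gt_0. rewrite Cmod_pow. apply pow_lt. now apply Cmod_gt_0. }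
    (* The numerator vanishes at 0, so the value of [/ 0] does not matter. *)
    assert (HH0 : H 0 = 0).
    { unfold H. rewrite HF0. change (0 ^ S n)%C with (0 * 0 ^ n)%C. ring. }
    assert (HOH : bigO 1 H).
    { destruct HO as (K & r & HK & Hr & HK').
      apply (bigO_intro _ _ (K ^ S n) r); [lra|].
      intros x Hx. destruct (Ceq_dec x 0) as [->|Hx0].
      - rewrite HH0, Cmod_0. simpl. lra.
      - assert (Hxp : 0 < Cmod x ^ n) by (apply pow_lt; now apply Cmod_gt_0).
        rewrite (Hmod x Hx0).
        apply (Rmult_le_reg_r (Cmod x ^ n)); [assumption|].
        unfold Rdiv. rewrite Rmult_assoc, Rinv_l, Rmult_1_r by lra.
        replace (K ^ S n * Cmod x ^ 1 * Cmod x ^ n) with ((K * Cmod x ^ 1) ^ S n).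
        + apply pow_incr. split; [apply Cmod_ge_0 | now apply HK'].
        + rewrite !pow_1, Rpow_mult_distr, <- !tech_pow_Rmult. ring. }
    assert (Hrn : 0 < rho ^ n) by (apply pow_lt; lra).
    assert (Hzn : 0 < Cmod z ^ n) by now apply pow_lt.
    assert (HM : Cmod (H z) <= / rho ^ n).
    { apply (maximum_modulus H rho); [lra| | assumption | | | | lra].
      - left. now apply Rinv_0_lt_compat.
      - intros d Hd. now apply bigO_small.
      - intros x Hx Hx0. unfold H. apply has_jet_mul.
        + apply has_jet_pow. now apply HF.
        + apply has_jet_inv.
          * apply Cmod_gt_0. rewrite Cmod_pow. apply pow_lt. now apply Cmod_gt_0.
          * apply has_jet_pow, has_jet_id.
      - intros x Hx. rewrite Hmod by (apply Cmod_gt_0; lra). rewrite Hx.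
        rewrite <- (Rmult_1_l (/ rho ^ n)). apply Rmult_le_compat_r.
        + left. now apply Rinv_0_lt_compat.
        + rewrite <- (pow1 (S n)). apply pow_incr. split; [apply Cmod_ge_0|].
          apply Hb. unfold U, Defs.disc. lra. }
    rewrite (Hmod z Hz0) in HM.
    apply (Rmult_le_reg_r (/ rho ^ n * / Cmod z ^ n)).
    - apply Rmult_lt_0_compat; now apply Rinv_0_lt_compat.
    - replace (Cmod (F z) ^ S n * rho ^ n * (/ rho ^ n * / Cmod z ^ n))
        with (Cmod (F z) ^ S n / Cmod z ^ n) by (field; lra).
      replace (Cmod z ^ n * (/ rho ^ n * / Cmod z ^ n)) with (/ rho ^ n)
        by (field; lra).
      assumption. }
  apply Rnot_lt_le. intros Hlt.
  assert (HF1 := Hb z Hz).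
  set (x := Cmod (F z)) in *. set (y := Cmod z) in *.
  (* Halfway between y / x and 1, so that x rho / y = (x + y) / (2 y) > 1. [Key] gives x (x rho /
     y)^n <= 1 for every n, which contradicts geometric growth. *)
  set (rho := (1 + y / x) / 2).
  assert (Hyx : y / x < 1).
  { apply (Rmult_lt_reg_r x); [lra|]. unfold Rdiv.
    rewrite Rmult_assoc, Rinv_l by lra. lra. }
  assert (Hyx' : y <= y / x).
  { apply (Rmult_le_reg_r x); [lra|]. unfold Rdiv.
    rewrite Rmult_assoc, Rinv_l by lra. nra. }
  assert (Hrho : y < rho < 1) by (unfold rho; lra).
  assert (Hq : 1 < x * rho / y).
  { apply (Rmult_lt_reg_r y); [lra|].
    replace (x * rho / y * y) with (x * rho) by (field; lra).
    unfold rho. replace (x * ((1 + y / x) / 2)) with ((x + y) / 2) by (field; lra).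
    lra. }
  destruct (Pow_x_infinity (x * rho / y) ltac:(rewrite Rabs_pos_eq; lra) (2 / x))
    as [N HN].
  specialize (HN N (le_n N)). specialize (Key N rho Hrho).
  rewrite Rabs_pos_eq in HN by (apply pow_le; lra).
  assert (Hk : x * (x * rho / y) ^ N <= 1).
  { unfold Rdiv. rewrite !Rpow_mult_distr, pow_inv.
    apply (Rmult_le_reg_r (y ^ N)); [now apply pow_lt|].
    assert (y ^ N <> 0) by (apply pow_nonzero; lra).
    replace (x * (x ^ N * rho ^ N * / y ^ N) * y ^ N) with (x ^ S N * rho ^ N)
      by (simpl; field; assumption).
    lra. }
  assert (x * (2 / x) <= x * (x * rho / y) ^ N) by (apply Rmult_le_compat_l; lra).
  replace (x * (2 / x)) with 2 in H by (field; lra). lra.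
Qed.

(** The difference of the squared moduli is (1 - |a|^2) (|z|^2 - |x|^2). This homogeneous form
    covers the Moebius transform of x / z without dividing by z. *)
Lemma Cmod_mobius (a x z : C) :
  Cmod a <= 1 -> Cmod x <= Cmod z ->
  Cmod (x - a * z) <= Cmod (z - Cconj a * x).
Proof.
  intros Ha Hx. apply Rle_of_pow2_le; try apply Cmod_ge_0.
  assert (Ha2 : Cmod a ^ 2 <= 1 ^ 2)
    by (apply pow_incr; split; [apply Cmod_ge_0 | assumption]).
  assert (Hx2 : Cmod x ^ 2 <= Cmod z ^ 2)
    by (apply pow_incr; split; [apply Cmod_ge_0 | assumption]).
  rewrite !Cmod_sq in *. destruct a as [a b], x as [x y], z as [u v]. simpl in *.
  assert (H : 0 <= (1 - (a ^ 2 + b ^ 2)) * ((u ^ 2 + v ^ 2) - (x ^ 2 + y ^ 2)))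
    by (apply Rmult_le_pos; simpl; lra).
  simpl in H. lra.
Qed.

(* The second-coefficient inequality is Schwarz's lemma for the Moebius
   transform of [t w(z)/z] sending its value at 0 to 0; the factor [t < 1] keeps
   the denominator away from 0 and is removed at the end. *)
Lemma schwarz_second_coef (w : C -> C) (c1 c2 c3 : C) :
  (forall z, U z -> has_jet w z) -> jet w 0 c1 c2 c3 ->
  (forall z, U z -> U (w z)) ->
  Cmod c1 <= 1 /\ Cmod c2 <= 1 - Cmod c1 ^ 2.
Proof.
  intros Hw Hj HU.
  assert (Hw1 : bigO 1 w).
  { generalize (jet_bigO1 _ _ _ _ _ Hj). apply bigO_ext. intros; ring. }
  assert (Hsch : forall z, U z -> Cmod (w z) <= Cmod z).
  { apply schwarz_lemma; auto. intros z Hz. left. exact (HU z Hz). }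
  assert (HO2 : bigO 2 (fun z => w z - c1 * z)%C).
  { apply (bigO_ext _ (fun z => (w z - cubic 0 c1 c2 c3 z) + z * (z * (c2 + z * c3)))%C);
      [intros; unfold cubic; ring|].
    apply bigO_add; [apply (bigO_le 4); [lia | exact Hj]|].
    do 2 apply bigO_zmul. apply bigO_add; [apply bigO_const|].
    apply (bigO_le 1); [lia|]. apply bigO_zmul, bigO_const. }
  assert (HO3 : bigO 3 (fun z => w z - c1 * z - c2 * (z * z))%C).
  { apply (bigO_ext _ (fun z => (w z - cubic 0 c1 c2 c3 z) + z * (z * (z * c3)))%C);
      [intros; unfold cubic; ring|].
    apply bigO_add; [apply (bigO_le 4); [lia | exact Hj]|].
    do 3 apply bigO_zmul. apply bigO_const. }
  destruct HO2 as (K2 & r2 & HK2 & Hr2 & H2).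
  destruct HO3 as (K3 & r3 & HK3 & Hr3 & H3).
  assert (Hreal : forall s, 0 < s -> Cmod (RtoC s) = s)
    by (intros s Hs; rewrite Cmod_R; apply Rabs_pos_eq; lra).
  assert (Hc1 : Cmod c1 <= 1).
  { apply (Rle_of_small_error _ _ K2 r2); [lra|]. intros s Hs.
    assert (Hm := Hreal s ltac:(lra)).
    specialize (H2 s ltac:(lra)). rewrite Hm in H2.
    assert (Hs1 := Hsch s ltac:(unfold U, Defs.disc; lra)). rewrite Hm in Hs1.
    apply (Rmult_le_reg_r s); [lra|].
    assert (Ht := Cmod_triangle (w s) (- (w s - c1 * s))).
    replace (w s + - (w s - c1 * s))%C with (c1 * s)%C in Ht by ring.
    rewrite Cmod_opp, Cmod_mult, Hm in Ht. simpl in H2. lra. }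
  split; [assumption|].
  assert (Ht : forall t, 0 < t < 1 -> t * Cmod c2 <= 1 - t ^ 2 * Cmod c1 ^ 2).
  { intros t Ht.
    assert (Hmt := Hreal t ltac:(lra)).
    (* Numerator and denominator of the Moebius transform of t w(z)/z are both multiplied by z. Near
       0, k(z) behaves like t c2 z / (1 - t^2 |c1|^2), so |k(z)| <= |z| contains the claim. *)
    set (den := fun z : C => (z - Cconj (t * c1) * (t * w z))%C).
    set (k := fun z : C => ((t * w z - t * c1 * z) * / den z)%C).
    assert (Hden : forall z, U z -> (1 - t ^ 2) * Cmod z <= Cmod (den z)).
    { intros z Hz. specialize (Hsch z Hz).
      assert (T := Cmod_triangle (den z) (Cconj (t * c1) * (t * w z))).
      replace (den z + Cconj (t * c1) * (t * w z))%C with z in T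
        by (unfold den; ring).
      rewrite !Cmod_mult, Cmod_conj, Cmod_mult, Hmt in T.
      assert (A1 := Cmod_ge_0 c1). assert (A2 := Cmod_ge_0 (w z)).
      assert (Cmod c1 * Cmod (w z) <= 1 * Cmod z) by (apply Rmult_le_compat; assumption).
      assert (t ^ 2 * (Cmod c1 * Cmod (w z)) <= t ^ 2 * (1 * Cmod z))
        by (apply Rmult_le_compat_l; [apply pow2_ge_0 | assumption]).
      lra. }
    assert (Ht2 : 0 < 1 - t ^ 2) by nra.
    assert (Hden0 : forall z, U z -> z <> 0 -> 0 < Cmod (den z)).
    { intros z Hz Hz0. apply Cmod_gt_0 in Hz0. specialize (Hden z Hz).
      assert (0 < (1 - t ^ 2) * Cmod z) by now apply Rmult_lt_0_compat. lra. }
    assert (Hmodk : forall z, U z -> z <> 0 ->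
      Cmod (k z) = t * Cmod (w z - c1 * z) / Cmod (den z)).
    { intros z Hz Hz0. unfold k. rewrite Cmod_mult, Cmod_inv
        by (apply Cmod_gt_0; auto).
      replace (t * w z - t * c1 * z)%C with (t * (w z - c1 * z))%C by ring.
      rewrite Cmod_mult, Hmt. reflexivity. }
    assert (Hw0 : w 0 = 0) by exact (jet_val0 _ _ _ _ _ Hj).
    assert (Hk0 : k 0 = 0) by (unfold k; rewrite Hw0; ring).
    assert (Hk : forall z, U z -> Cmod (k z) <= Cmod z).
    { apply schwarz_lemma.
      - intros z Hz Hz0. unfold k. apply has_jet_mul.
        + apply has_jet_add.
          * apply has_jet_mul; [apply has_jet_const | auto].
          * destruct (has_jet_mul _ _ z (has_jet_const (- (t * c1)) z) (has_jet_id z))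
              as (d0 & d1 & d2 & d3 & Hd).
            exists d0, d1, d2, d3. revert Hd. apply bigO_ext. intros; ring.
        + apply has_jet_inv; [apply Cmod_gt_0; auto|]. unfold den.
          apply has_jet_add; [apply has_jet_id|].
          destruct (has_jet_mul _ _ z (has_jet_const (- (Cconj (t * c1) * t)) z)
            (Hw z Hz)) as (d0 & d1 & d2 & d3 & Hd).
          exists d0, d1, d2, d3. revert Hd. apply bigO_ext. intros; ring.
      - apply (bigO_intro _ _ (t * K2 / (1 - t ^ 2)) r2); [lra|].
        intros z Hz. assert (HUz : U z) by (unfold U, Defs.disc; lra).
        destruct (Ceq_dec z 0) as [->|Hz0]; [rewrite Hk0, Cmod_0; simpl; lra|].
        rewrite (Hmodk z HUz Hz0). specialize (H2 z Hz). specialize (Hden z HUz).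
        specialize (Hden0 z HUz Hz0).
        apply (Rmult_le_reg_r (Cmod (den z))); [assumption|].
        unfold Rdiv at 1. rewrite Rmult_assoc, Rinv_l, Rmult_1_r by lra.
        apply Rle_trans with (t * K2 / (1 - t ^ 2) * Cmod z ^ 1 * ((1 - t ^ 2) * Cmod z)).
        + replace (t * K2 / (1 - t ^ 2) * Cmod z ^ 1 * ((1 - t ^ 2) * Cmod z))
            with (t * (K2 * Cmod z ^ 2)) by (field; lra).
          apply Rmult_le_compat_l; lra.
        + apply Rmult_le_compat_l; [|assumption].
          apply Rmult_le_pos; [|apply pow_le, Cmod_ge_0].
          apply Rmult_le_pos; [apply Rmult_le_pos; lra|].
          left. now apply Rinv_0_lt_compat.
      - intros z HUz.
        destruct (Ceq_dec z 0) as [->|Hz0]; [rewrite Hk0, Cmod_0; lra|].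
        specialize (Hden0 z HUz Hz0). specialize (Hsch z HUz).
        unfold k. rewrite Cmod_mult, Cmod_inv by now apply Cmod_gt_0.
        apply (Rmult_le_reg_r (Cmod (den z))); [assumption|].
        rewrite Rmult_assoc, Rinv_l, Rmult_1_r, Rmult_1_l by lra.
        apply Cmod_mobius; rewrite Cmod_mult, Hmt.
        + assert (A1 := Cmod_ge_0 c1). nra.
        + assert (A2 := Cmod_ge_0 (w z)). nra. }
    assert (Hmc : Cmod (1 - Cconj (t * c1) * (t * c1)) = 1 - t ^ 2 * Cmod c1 ^ 2).
    { rewrite Cmult_comm, <- Cmod2_conj, Cmod_mult, Hmt, <- RtoC_minus, Cmod_R.
      rewrite Rabs_pos_eq; [ring|].
      assert (A1 := Cmod_ge_0 c1). assert (t * Cmod c1 <= 1) by nra. nra. }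
    (* At a real point s, |k(s)| <= s reads t |w(s) - c1 s| <= s |den s|; up to O(s^3) the two sides
       are s^2 times the two sides of the claim. *)
    apply (Rle_of_small_error _ _ (K3 + K2) (Rmin r2 r3)); [apply Rmin_pos; lra|].
    intros s [Hs0 Hs].
    assert (Hs2 : s < r2) by (eapply Rlt_le_trans; [exact Hs | apply Rmin_l]).
    assert (Hs3 : s < r3) by (eapply Rlt_le_trans; [exact Hs | apply Rmin_r]).
    assert (Hm := Hreal s Hs0).
    specialize (H2 s ltac:(lra)). specialize (H3 s ltac:(lra)).
    assert (HUs : U s) by (unfold U, Defs.disc; lra).
    assert (Hs_ne : RtoC s <> 0) by (apply Cmod_gt_0; lra).
    specialize (Hk s HUs). specialize (Hden0 s HUs Hs_ne).
    rewrite (Hmodk s HUs Hs_ne) in Hk. rewrite Hm in *.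
    assert (Hk' : t * Cmod (w s - c1 * s) <= s * Cmod (den s)).
    { apply (Rmult_le_reg_r (/ Cmod (den s))); [now apply Rinv_0_lt_compat|].
      rewrite (Rmult_assoc s), Rinv_r, Rmult_1_r by lra. exact Hk. }
    assert (Hd : Cmod (den s) <= s * (1 - t ^ 2 * Cmod c1 ^ 2) + K2 * s ^ 2).
    { replace (den s) with (s * (1 - Cconj (t * c1) * (t * c1))
                            + - (Cconj (t * c1) * t * (w s - c1 * s)))%C
        by (unfold den; ring).
      eapply Rle_trans; [apply Cmod_triangle|].
      rewrite Cmod_opp, !Cmod_mult, Hmc, Hm, Cmod_conj, Cmod_mult, Hmt.
      apply Rplus_le_compat_l.
      assert (A1 := Cmod_ge_0 c1). assert (A2 := Cmod_ge_0 (w s - c1 * s)).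
      apply Rle_trans with (1 * Cmod (w s - c1 * s)); [|lra].
      apply Rmult_le_compat_r; [assumption|]. nra. }
    assert (Hn : Cmod c2 * s ^ 2 <= Cmod (w s - c1 * s) + K3 * s ^ 3).
    { assert (T := Cmod_triangle (w s - c1 * s) (- (w s - c1 * s - c2 * (s * s)))).
      replace (w s - c1 * s + - (w s - c1 * s - c2 * (s * s)))%C
        with (c2 * (s * s))%C in T by ring.
      rewrite Cmod_opp, !Cmod_mult, Hm in T. simpl in *. lra. }
    apply (Rmult_le_reg_r (s ^ 2)); [apply pow_lt; lra|].
    assert (Hn' : t * (Cmod c2 * s ^ 2)
                  <= t * Cmod (w s - c1 * s) + K3 * s ^ 3).
    { assert (A : 0 <= K3 * s ^ 3) by (apply Rmult_le_pos; [lra | apply pow_le; lra]).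
      nra. }
    assert (Hd' : s * Cmod (den s) <= s * (s * (1 - t ^ 2 * Cmod c1 ^ 2) + K2 * s ^ 2))
      by (apply Rmult_le_compat_l; lra).
    lra. }
  (* With t = 1 - s, both t |c2| and t^2 |c1|^2 differ from their limits by at most this constant
     times s in total. *)
  apply (Rle_of_small_error _ _ (Cmod c2 + 2 * Cmod c1 ^ 2) 1); [lra|].
  intros s Hs. specialize (Ht (1 - s) ltac:(lra)).
  assert (A : 0 <= Cmod c1 ^ 2) by apply pow2_ge_0. nra.
Qed.

(** * Complex power series *)

Notation C_series := (@is_series C_AbsRing C_NormedModule).

Lemma C_series_cv (a : nat -> C) (l : C) (e : R) :
  C_series a l -> 0 < e ->
  exists N : nat, forall n, (N <= n)%nat ->
    Cmod ((@sum_n C_AbelianMonoid a n : C) - l) < e.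
Proof.
  intros H He.
  destruct (proj1 (filterlim_locally_ball_norm _ _) H (mkposreal e He)) as [N HN].
  exists N. exact HN.
Qed.

Lemma C_series_norm_le (a : nat -> C) (l : C) (M : R) :
  C_series a l ->
  (forall n, Cmod (@sum_n C_AbelianMonoid a n) <= M) -> Cmod l <= M.
Proof.
  intros H HM. apply Rnot_lt_le. intros Hlt.
  destruct (C_series_cv a l (Cmod l - M) H ltac:(lra)) as [N HN].
  specialize (HN N (le_n N)). specialize (HM N).
  set (S := @sum_n C_AbelianMonoid a N : C) in *.
  assert (T := Cmod_triangle S (- (S - l))).
  replace (S + - (S - l))%C with l in T by ring.
  rewrite Cmod_opp in T. change (Cmod S <= M) in HM. lra.
Qed.

(** Ratio 1/2 serves for all comparisons below; radii are shrunk until it is reached. *)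
Lemma C_series_geom_le (a : nat -> C) (l : C) (M : R) :
  C_series a l -> (forall n, Cmod (a n) <= M * (1 / 2) ^ n) -> Cmod l <= 2 * M.
Proof.
  intros H Ha.
  assert (HM : 0 <= M) by (specialize (Ha 0%nat); assert (A := Cmod_ge_0 (a 0%nat)); simpl in Ha; lra).
  apply (C_series_norm_le a l _ H). intros n.
  assert (Hn : Cmod (@sum_n C_AbelianMonoid a n) <= M * (2 - (1 / 2) ^ n)).
  { induction n as [|n IH].
    - rewrite sum_O. specialize (Ha 0%nat). simpl in *. lra.
    - rewrite sum_Sn. eapply Rle_trans; [apply Cmod_triangle|].
      specialize (Ha (S n)). simpl in *. lra. }
  assert (0 < (1 / 2) ^ n) by (apply pow_lt; lra). nra.
Qed.

Lemma C_ex_series_geom (a : nat -> C) (M : R) :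
  (forall n, Cmod (a n) <= M * (1 / 2) ^ n) -> exists l : C, C_series a l.
Proof.
  intros Ha.
  destruct (@ex_series_le C_AbsRing C_CompleteNormedModule a (fun n => M * (1 / 2) ^ n))
    as [l Hl].
  - exact Ha.
  - apply (ex_series_scal_l M (fun n => (1 / 2) ^ n)).
    apply ex_series_geom. rewrite Rabs_pos_eq; lra.
  - now exists l.
Qed.

Lemma C_series_bounded (a : nat -> C) (l : C) :
  C_series a l -> exists M, forall n, Cmod (a n) <= M.
Proof.
  intros H. destruct (C_series_cv a l 1 H ltac:(lra)) as [N HN].
  assert (Hfin : forall m, exists M, forall n, (n <= m)%nat -> Cmod (a n) <= M).
  { induction m as [|m [M HM]].
    - exists (Cmod (a 0%nat)). intros n Hn. replace n with 0%nat by lia. lra.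
    - exists (Rmax M (Cmod (a (S m)))). intros n Hn.
      destruct (Nat.eq_dec n (S m)) as [->|Hne]; [apply Rmax_r|].
      eapply Rle_trans; [apply HM; lia | apply Rmax_l]. }
  (* Beyond N a term is the difference of two partial sums within 1 of l, hence the 2. *)
  destruct (Hfin N) as [M HM]. exists (Rmax M 2). intros n.
  destruct (Nat.le_gt_cases n N) as [Hle|Hgt].
  - eapply Rle_trans; [now apply HM | apply Rmax_l].
  - eapply Rle_trans; [|apply Rmax_r].
    destruct n as [|n]; [lia|].
    assert (H1 := HN n ltac:(lia)). assert (H2 := HN (S n) ltac:(lia)).
    rewrite sum_Sn in H2.
    set (S := @sum_n C_AbelianMonoid a n : C) in *.
    change (Cmod (S + a (Datatypes.S n) - l) < 1) in H2.
    assert (T := Cmod_triangle (S + a (Datatypes.S n) - l) (- (S - l))).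
    replace (S + a (Datatypes.S n) - l + - (S - l))%C with (a (Datatypes.S n)) in T by ring.
    rewrite Cmod_opp in T. lra.
Qed.

Lemma pow_n_Cpow (z : C) (n : nat) : @pow_n C_Ring z n = (z ^ n)%C.
Proof.
  induction n as [|n IH]; [reflexivity|].
  exact (f_equal (Cmult z) IH).
Qed.

Lemma C_psum_series (c : nat -> C) (z l : C) :
  C_psum c z l <-> C_series (fun n => z ^ n * c n)%C l.
Proof.
  split; intros H; revert H; apply is_series_ext; intros n.
  - exact (f_equal (fun x : C => x * c n)%C (pow_n_Cpow z n)).
  - exact (f_equal (fun x : C => x * c n)%C (eq_sym (pow_n_Cpow z n))).
Qed.

(** Plays the part of Cauchy's estimates: the terms of a series convergent at s are bounded. *)
Lemma C_psum_coef_bound (c : nat -> C) (s : R) (l : C) :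
  0 < s -> C_psum c s l ->
  exists M, 0 <= M /\ forall n, Cmod (c n) <= M * / s ^ n.
Proof.
  intros Hs H. apply C_psum_series, C_series_bounded in H. destruct H as [M HM].
  exists M. split.
  - eapply Rle_trans; [apply Cmod_ge_0 | apply (HM 0%nat)].
  - intros n. specialize (HM n).
    rewrite Cmod_mult, Cmod_pow, Cmod_R, Rabs_pos_eq in HM by lra.
    assert (Hp : 0 < s ^ n) by now apply pow_lt.
    apply (Rmult_le_reg_l (s ^ n)); [assumption|].
    replace (s ^ n * (M * / s ^ n)) with M by (field; lra). exact HM.
Qed.

Lemma C_psum_bigO0 (c : nat -> C) (F : C -> C) (r : R) :
  0 < r -> (forall z, Cmod z < r -> C_psum c z (F z)) -> bigO 0 F.
Proof.
  intros Hr H.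
  assert (Hm : Cmod (RtoC (r / 2)) = r / 2) by (rewrite Cmod_R, Rabs_pos_eq; lra).
  destruct (C_psum_coef_bound c (r / 2) (F (r / 2)) ltac:(lra) (H (RtoC (r / 2)) ltac:(lra)))
    as (M & HM & Hc).
  apply (bigO_intro _ _ (2 * M) (r / 4)); [lra|].
  intros z Hz. simpl. rewrite Rmult_1_r.
  apply (C_series_geom_le (fun n => z ^ n * c n)%C).
  - apply C_psum_series, H. lra.
  - intros n. rewrite Cmod_mult, Cmod_pow.
    assert (Hp : 0 < (r / 2) ^ n) by (apply pow_lt; lra).
    apply Rle_trans with ((r / 4) ^ n * (M * / (r / 2) ^ n)).
    + apply Rmult_le_compat; try apply Cmod_ge_0; [apply pow_le, Cmod_ge_0| |apply Hc].
      apply pow_incr. split; [apply Cmod_ge_0 | lra].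
    + right. replace (r / 4) with (1 / 2 * (r / 2)) by field.
      rewrite (Rpow_mult_distr (1 / 2)). field. lra.
Qed.

Lemma C_psum_at_0 (c : nat -> C) (l : C) : C_psum c 0 l -> l = c 0%nat.
Proof.
  intros H.
  exact (filterlim_locally_unique _ _ _ H (is_pseries_0 c)).
Qed.

Lemma C_psum_shift (c : nat -> C) (F : C -> C) (r : R) :
  (forall z, Cmod z < r -> C_psum c z (F z)) ->
  exists F1 : C -> C,
    (forall z, Cmod z < r -> C_psum (fun n => c (S n)) z (F1 z)) /\
    forall z, Cmod z < r -> F z = (c 0%nat + z * F1 z)%C.
Proof.
  intros H.
  exists (fun z => if Ceq_dec z 0 then c 1%nat else (/ z * (F z - c 0%nat))%C).
  split; intros z Hz; specialize (H z Hz); destruct (Ceq_dec z 0) as [->|Hz0].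
  - exact (is_pseries_0 (fun n => c (S n))).
  - exact (is_pseries_decr_1 c z (/ z)%C (F z) (Cinv_l z Hz0) H).
  - apply C_psum_at_0 in H. rewrite H. ring.
  - now field.
Qed.

(** Four shifts write F as its cubic plus z^4 F4, where F4 is the sum of the shifted series and so
    is bounded near 0. *)
Lemma C_psum_jet (c : nat -> C) (F : C -> C) (r : R) :
  0 < r -> (forall z, Cmod z < r -> C_psum c z (F z)) ->
  jet F (c 0%nat) (c 1%nat) (c 2%nat) (c 3%nat).
Proof.
  intros Hr H.
  destruct (C_psum_shift _ _ _ H) as (F1 & H1 & E1).
  destruct (C_psum_shift _ _ _ H1) as (F2 & H2 & E2).
  destruct (C_psum_shift _ _ _ H2) as (F3 & H3 & E3).
  destruct (C_psum_shift _ _ _ H3) as (F4 & H4 & E4).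
  apply (bigO_ext_loc _ (fun z => z * (z * (z * (z * F4 z))))%C _ r); [assumption| |].
  - intros z Hz. rewrite (E1 z Hz), (E2 z Hz), (E3 z Hz), (E4 z Hz).
    unfold cubic. ring.
  - do 4 apply bigO_zmul. exact (C_psum_bigO0 _ _ r Hr H4).
Qed.

Lemma analytic_has_jet (D : C -> Prop) (F : C -> C) (z0 : C) :
  analytic_in D F -> D z0 -> has_jet F z0.
Proof.
  intros HF Hz0. destruct (HF z0 Hz0) as (c & r & H).
  exists (c 0%nat), (c 1%nat), (c 2%nat), (c 3%nat).
  apply (C_psum_jet c _ r); [apply cond_pos|].
  intros h Hh. specialize (H (z0 + h)%C).
  replace (z0 + h - z0)%C with h in H by ring. now apply H.
Qed.

Lemma analytic_jet_0 (D : C -> Prop) (F : C -> C) :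
  analytic_in D F -> D 0 -> exists c1 c2 c3 : C, jet F (F 0) c1 c2 c3.
Proof.
  intros HF H0. destruct (analytic_has_jet D F 0 HF H0) as (c0 & c1 & c2 & c3 & H).
  exists c1, c2, c3.
  assert (Hj : jet F c0 c1 c2 c3).
  { revert H. apply (jet_ext_loc _ _ _ _ _ _ 1); [lra|].
    intros z _. f_equal. ring. }
  now rewrite (jet_val0 _ _ _ _ _ Hj).
Qed.

(** The remainders satisfy e_(n+1) = (z + h) e_n + n h^2 z^(n-1), and n^2 + n <= (n + 1)^2 closes
    the induction. The factor rho^2 on the left avoids the exponent n - 2 for n < 2. *)
Lemma pow_taylor_remainder (z h : C) (rho : R) (n : nat) :
  Cmod z <= rho -> Cmod (z + h) <= rho -> 0 < rho ->
  Cmod ((z + h) ^ n - z ^ n - h * (INR n * z ^ pred n)) * rho ^ 2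
    <= INR n ^ 2 * rho ^ n * Cmod h ^ 2.
Proof.
  intros Hz Hzh Hrho. induction n as [|n IH].
  - simpl. replace (1 - 1 - h * (0 * 1))%C with (RtoC 0) by ring.
    rewrite Cmod_0. lra.
  - set (e := ((z + h) ^ n - z ^ n - h * (INR n * z ^ pred n))%C) in *.
    replace ((z + h) ^ S n - z ^ S n - h * (INR (S n) * z ^ pred (S n)))%C
      with ((z + h) * e + INR n * (h * h * z ^ pred n))%C.
    2: { unfold e. rewrite S_INR, RtoC_plus. simpl pred.
         destruct n as [|n]; simpl; ring. }
    assert (T := Cmod_triangle ((z + h) * e) (INR n * (h * h * z ^ pred n))).
    rewrite !Cmod_mult, Cmod_pow, Cmod_R, (Rabs_pos_eq (INR n)) in T by apply pos_INR.
    assert (Hr2 : 0 < rho ^ 2) by now apply pow_lt.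
    assert (Hn := pos_INR n).
    assert (A1 : Cmod (z + h) * Cmod e * rho ^ 2 <= rho * (INR n ^ 2 * rho ^ n * Cmod h ^ 2)).
    { rewrite Rmult_assoc. apply Rmult_le_compat; try apply Cmod_ge_0; try assumption.
      apply Rmult_le_pos; [apply Cmod_ge_0 | lra]. }
    assert (A2 : INR n * (Cmod h * Cmod h * Cmod z ^ pred n) * rho ^ 2
                 <= INR n * (Cmod h ^ 2 * rho ^ S n)).
    { destruct n as [|n]; [simpl; lra|]. simpl pred.
      rewrite Rmult_assoc. apply Rmult_le_compat_l; [assumption|].
      replace (Cmod h ^ 2 * rho ^ S (S n)) with (Cmod h * Cmod h * rho ^ n * rho ^ 2)
        by (simpl; ring).
      apply Rmult_le_compat_r; [lra|]. apply Rmult_le_compat_l.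
      - apply Rmult_le_pos; apply Cmod_ge_0.
      - apply pow_incr. split; [apply Cmod_ge_0 | assumption]. }
    assert (A3 : 0 <= rho ^ S n * Cmod h ^ 2)
      by (apply Rmult_le_pos; apply pow_le; [lra | apply Cmod_ge_0]).
    rewrite S_INR.
    apply Rle_trans with ((Cmod (z + h) * Cmod e + INR n * (Cmod h * Cmod h * Cmod z ^ pred n)) * rho ^ 2).
    + apply Rmult_le_compat_r; lra.
    + rewrite Rmult_plus_distr_r.
      apply Rle_trans with (INR n ^ 2 * (rho ^ S n * Cmod h ^ 2)
                            + INR n * (rho ^ S n * Cmod h ^ 2)).
      * simpl in *. lra.
      * replace ((INR n + 1) ^ 2 * rho ^ S n * Cmod h ^ 2)
          with ((INR n + 1) ^ 2 * (rho ^ S n * Cmod h ^ 2)) by ring.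
        nra.
Qed.

Lemma is_derive_of_quadratic_error (F : C -> C) (z l : C) (B d : R) :
  0 < d ->
  (forall h, Cmod h < d -> Cmod (F (z + h)%C - F z - h * l) <= B * Cmod h ^ 2) ->
  @is_derive C_AbsRing C_NormedModule F z l.
Proof.
  intros Hd H. split; [apply is_linear_scal_l|].
  intros x Hx.
  apply (@is_filter_lim_locally_unique _ (AbsRing_NormedModule C_AbsRing)) in Hx.
  subst x.
  intros [e He]. simpl.
  apply (@locally_le_locally_norm _ (AbsRing_NormedModule C_AbsRing)).
  assert (HB : 0 <= Rabs B) by apply Rabs_pos.
  assert (Hq : 0 < Rmin d (e / (Rabs B + 1)))
    by (apply Rmin_pos; [|apply Rdiv_lt_0_compat]; lra).
  exists (mkposreal _ Hq). simpl. intros y Hy.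
  change (Cmod (y - z) < Rmin d (e / (Rabs B + 1))) in Hy.
  change (Cmod (F y - F z - (y - z) * l) <= e * Cmod (y - z)).
  specialize (H (y - z)%C ltac:(eapply Rlt_le_trans; [exact Hy | apply Rmin_l])).
  replace (z + (y - z))%C with y in H by ring.
  eapply Rle_trans; [exact H|].
  assert (Hy2 : Cmod (y - z) < e / (Rabs B + 1))
    by (eapply Rlt_le_trans; [exact Hy | apply Rmin_r]).
  assert (A := Cmod_ge_0 (y - z)).
  assert (Hlt : Cmod (y - z) * (Rabs B + 1) <= e).
  { replace e with (e / (Rabs B + 1) * (Rabs B + 1)) by (field; lra).
    apply Rmult_le_compat_r; lra. }
  assert (HBB := Rle_abs B).
  replace (B * Cmod (y - z) ^ 2) with (B * Cmod (y - z) * Cmod (y - z)) by ring.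
  apply Rmult_le_compat_r; [assumption|]. nra.
Qed.

Lemma INR_sq_le_pow2 (n : nat) : INR n ^ 2 <= 4 * 2 ^ n /\ INR n <= 2 ^ n.
Proof.
  assert (H : INR n <= 2 ^ n).
  { induction n as [|n IH]; [simpl; lra|]. rewrite S_INR. simpl.
    assert (1 <= 2 ^ n) by (apply pow_R1_Rle; lra). lra. }
  split; [|assumption].
  (* The lower terms make the induction go through: the left side at n + 1 is n^2 + 4 n + 6, at most
     twice its value at n. *)
  assert (H2 : INR n ^ 2 + 2 * INR n + 3 <= 4 * 2 ^ n); [|assert (A := pos_INR n); lra].
  induction n as [|[|n] IH]; [simpl; lra|simpl; lra|].
  assert (H' : INR (S n) <= 2 ^ S n).
  { clear. induction n as [|n IH]; [simpl; lra|]. rewrite S_INR.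
    assert (1 <= 2 ^ S n) by (apply pow_R1_Rle; lra). simpl in *. lra. }
  specialize (IH H'). rewrite (S_INR (S n)).
  assert (1 <= INR (S n)) by (rewrite S_INR; assert (A := pos_INR n); lra).
  rewrite <- (tech_pow_Rmult 2 (S n)). nra.
Qed.

Lemma C_psum_derive (c : nat -> C) (F : C -> C) (r : R) :
  0 < r -> (forall z, Cmod z < r -> C_psum c z (F z)) ->
  exists d, 0 < d /\ forall z, Cmod z < d ->
    C_psum (fun n => INR (S n) * c (S n))%C z (C_derive F z).
Proof.
  intros Hr H.
  set (s := r / 2). assert (Hs : 0 < s) by (unfold s; lra).
  assert (Hm : Cmod (RtoC s) = s) by (rewrite Cmod_R, Rabs_pos_eq; lra).
  destruct (C_psum_coef_bound c s (F s) Hs (H (RtoC s) ltac:(unfold s in *; lra)))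
    as (M & HM & Hc).
  (* A quarter gives (rho / s)^n = (1/2)^n (1/2)^n: one factor absorbs n or n^2, the other leaves a
     geometric series. Taking z and h below rho / 2 keeps z + h within rho. *)
  set (rho := s / 4). assert (Hrho : 0 < rho) by (unfold rho; lra).
  assert (Hquot : forall n, rho ^ n * / s ^ n = (1 / 2) ^ n * (1 / 2) ^ n).
  { intros n. assert (s ^ n <> 0) by (apply pow_nonzero; lra).
    replace rho with (1 / 2 * (1 / 2) * s) by (unfold rho; field).
    rewrite !Rpow_mult_distr. field. assumption. }
  assert (Hhalf : forall n, 2 ^ n * (1 / 2) ^ n = 1).
  { intros n. rewrite <- Rpow_mult_distr. replace (2 * (1 / 2)) with 1 by field.
    apply pow1. }
  assert (Hh0 : forall n, 0 < (1 / 2) ^ n) by (intros; apply pow_lt; lra).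
  exists (rho / 2). split; [lra|]. intros z Hz.
  set (t := fun n => (INR n * z ^ pred n * c n)%C).
  assert (Ht : forall n, Cmod (t n) <= M / rho * (1 / 2) ^ n).
  { intros n. unfold t.
    rewrite !Cmod_mult, Cmod_pow, Cmod_R, Rabs_pos_eq by apply pos_INR.
    destruct n as [|n].
    - simpl INR. rewrite !Rmult_0_l. apply Rmult_le_pos; [|left; apply Hh0].
      apply Rmult_le_pos; [assumption|]. left; now apply Rinv_0_lt_compat.
    - simpl pred.
      apply Rle_trans with (INR (S n) * rho ^ n * (M * / s ^ S n)).
      + apply Rmult_le_compat; try apply Cmod_ge_0; [| |apply Hc].
        * apply Rmult_le_pos; [apply pos_INR | apply pow_le, Cmod_ge_0].
        * apply Rmult_le_compat_l; [apply pos_INR|].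
          apply pow_incr. split; [apply Cmod_ge_0 | lra].
      + replace (INR (S n) * rho ^ n * (M * / s ^ S n))
          with (M / rho * (INR (S n) * (rho ^ S n * / s ^ S n))).
        2: { rewrite <- !tech_pow_Rmult. field.
             split; [apply pow_nonzero|split]; lra. }
        apply Rmult_le_compat_l.
        * apply Rmult_le_pos; [assumption|]. left; now apply Rinv_0_lt_compat.
        * rewrite Hquot, <- Rmult_assoc.
          rewrite <- (Rmult_1_l ((1 / 2) ^ S n)) at 3.
          apply Rmult_le_compat_r; [left; apply Hh0|].
          eapply Rle_trans; [|right; apply (Hhalf (S n))].
          apply Rmult_le_compat_r; [left; apply Hh0 | apply INR_sq_le_pow2]. }
  destruct (C_ex_series_geom t _ Ht) as [D HD].
  assert (HDz : @is_derive C_AbsRing C_NormedModule F z D).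
  { apply (is_derive_of_quadratic_error F z D (8 * M / rho ^ 2) (rho / 2)); [lra|].
    intros h Hh.
    assert (Hzh : Cmod (z + h) <= rho)
      by (eapply Rle_trans; [apply Cmod_triangle|]; lra).
    assert (Hlt : rho < r) by (unfold rho, s; lra).
    assert (S1 := proj1 (C_psum_series _ _ _) (H (z + h)%C ltac:(lra))).
    assert (S2 := proj1 (C_psum_series _ _ _) (H z ltac:(lra))).
    assert (S3 : C_series (fun n => (z + h) ^ n * c n - z ^ n * c n - h * t n)%C
                   (F (z + h)%C - F z - h * D)%C).
    { exact (is_series_minus _ _ _ _ (is_series_minus _ _ _ _ S1 S2)
               (is_series_scal h _ _ HD)). }
    replace (8 * M / rho ^ 2 * Cmod h ^ 2) with (2 * (4 * M / rho ^ 2 * Cmod h ^ 2))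
      by (field; lra).
    apply (C_series_geom_le _ _ _ S3). intros n.
    replace ((z + h) ^ n * c n - z ^ n * c n - h * t n)%C
      with (((z + h) ^ n - z ^ n - h * (INR n * z ^ pred n)) * c n)%C
      by (unfold t; ring).
    rewrite Cmod_mult.
    assert (P := pow_taylor_remainder z h rho n ltac:(lra) Hzh Hrho).
    set (E := Cmod ((z + h) ^ n - z ^ n - h * (INR n * z ^ pred n))) in *.
    assert (Hr2 : 0 < rho ^ 2) by now apply pow_lt.
    apply (Rmult_le_reg_r (rho ^ 2)); [assumption|].
    replace (E * Cmod (c n) * rho ^ 2) with (E * rho ^ 2 * Cmod (c n)) by ring.
    apply Rle_trans with (INR n ^ 2 * rho ^ n * Cmod h ^ 2 * (M * / s ^ n)).
    - apply Rmult_le_compat; [|apply Cmod_ge_0|assumption|apply Hc].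
      apply Rmult_le_pos; [apply Cmod_ge_0 | lra].
    - replace (INR n ^ 2 * rho ^ n * Cmod h ^ 2 * (M * / s ^ n))
        with (M * Cmod h ^ 2 * (INR n ^ 2 * (rho ^ n * / s ^ n))) by ring.
      replace (4 * M / rho ^ 2 * Cmod h ^ 2 * (1 / 2) ^ n * rho ^ 2)
        with (M * Cmod h ^ 2 * (4 * (1 / 2) ^ n)) by (field; lra).
      apply Rmult_le_compat_l.
      + apply Rmult_le_pos; [assumption | apply pow_le, Cmod_ge_0].
      + rewrite Hquot, <- Rmult_assoc. apply Rmult_le_compat_r; [left; apply Hh0|].
        apply Rle_trans with (4 * 2 ^ n * (1 / 2) ^ n).
        * apply Rmult_le_compat_r; [left; apply Hh0 | apply INR_sq_le_pow2].
        * rewrite Rmult_assoc, Hhalf. lra. }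
  rewrite (is_C_derive_unique F z D HDz).
  apply C_psum_series.
  apply (is_series_ext (fun n => t (S n))).
  - intros n. change (t (S n) = z ^ n * (INR (S n) * c (S n)))%C.
    unfold t. simpl pred. ring.
  - apply (is_series_incr_1 t).
    (* The differentiated series was summed from n = 0, where its term is 0; dropping that term
       gives the shifted coefficients. *)
    assert (HD0 : D = plus D (t 0%nat))
      by (change (D = D + t 0%nat)%C; unfold t; simpl; ring).
    rewrite HD0 in HD. exact HD.
Qed.

(** * The exponential *)

(** By the mean value theorem a bound on the derivative gains one order; the factor 1/(n+1) of true
    integration is given up. Repeated use yields all real Taylor estimates below. *)
Lemma taylor_step (f df : R -> R) (K : R) (n : nat) :
  0 <= K -> f 0 = 0 -> (forall x, is_derive f x (df x)) ->
  (forall x, Rabs x <= 1 -> Rabs (df x) <= K * Rabs x ^ n) ->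
  forall x, Rabs x <= 1 -> Rabs (f x) <= K * Rabs x ^ S n.
Proof.
  intros HK Hf0 Hd Hb x Hx.
  destruct (MVT_gen f 0 x df) as (c & Hc & E).
  - intros y _. apply Hd.
  - intros y _. apply continuity_pt_filterlim.
    apply (ex_derive_continuous (V := R_NormedModule)). exists (df y). apply Hd.
  - assert (Hcx : Rabs c <= Rabs x).
    { destruct (Rle_or_lt 0 x) as [H|H].
      - rewrite Rmin_left, Rmax_right in Hc by lra. rewrite !Rabs_pos_eq; lra.
      - rewrite Rmin_right, Rmax_left in Hc by lra. rewrite !Rabs_left1; lra. }
    replace (f x) with (df c * x) by (rewrite Hf0 in E; lra).
    rewrite Rabs_mult, <- tech_pow_Rmult.
    replace (K * (Rabs x * Rabs x ^ n)) with (K * Rabs x ^ n * Rabs x) by ring.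
    apply Rmult_le_compat_r; [apply Rabs_pos|].
    eapply Rle_trans; [apply Hb; lra|].
    apply Rmult_le_compat_l; [assumption|].
    apply pow_incr. split; [apply Rabs_pos | assumption].
Qed.

Lemma exp_taylor3 (x : R) : Rabs x <= 1 ->
  Rabs (exp x - (1 + x + x ^ 2 / 2 + x ^ 3 / 6)) <= 3 * Rabs x ^ 4.
Proof.
  revert x.
  apply (taylor_step (fun x => exp x - (1 + x + x ^ 2 / 2 + x ^ 3 / 6))
           (fun x => exp x - (1 + x + x ^ 2 / 2))).
  { lra. } { simpl. rewrite exp_0. field. }
  { intros x. auto_derive; [trivial|]. field. }
  apply (taylor_step _ (fun x => exp x - (1 + x))).
  { lra. } { simpl. rewrite exp_0. field. }
  { intros x. auto_derive; [trivial|]. field. }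
  apply (taylor_step _ (fun x => exp x - 1)).
  { lra. } { simpl. rewrite exp_0. field. }
  { intros x. auto_derive; [trivial|]. field. }
  apply (taylor_step _ exp).
  { lra. } { rewrite exp_0. field. }
  { intros x. auto_derive; [trivial|]. field. }
  intros x Hx. rewrite Rabs_pos_eq by (left; apply exp_pos). simpl.
  apply Rabs_le_between in Hx.
  apply Rle_trans with (exp 1); [|generalize exp_le_3; lra].
  destruct (Req_dec x 1) as [->|]; [lra|]. left. apply exp_increasing. lra.
Qed.

Lemma sin_taylor1 (x : R) : Rabs x <= 1 -> Rabs (sin x) <= 1 * Rabs x ^ 1.
Proof.
  revert x. apply (taylor_step _ cos).
  { lra. } { apply sin_0. }
  { intros x. auto_derive; [trivial|]. ring. }
  intros x _. simpl. rewrite !Rmult_1_r. apply Rabs_le. apply COS_bound.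
Qed.

Lemma cos_taylor2 (x : R) : Rabs x <= 1 -> Rabs (cos x - 1) <= 1 * Rabs x ^ 2.
Proof.
  revert x. apply (taylor_step _ (fun x => - sin x)).
  { lra. } { rewrite cos_0. ring. }
  { intros x. auto_derive; [trivial|]. ring. }
  intros x Hx. rewrite Rabs_Ropp. now apply sin_taylor1.
Qed.

Lemma sin_taylor3 (x : R) : Rabs x <= 1 -> Rabs (sin x - x) <= 1 * Rabs x ^ 3.
Proof.
  revert x. apply (taylor_step _ (fun x => cos x - 1)).
  { lra. } { rewrite sin_0. ring. }
  { intros x. auto_derive; [trivial|]. ring. }
  exact cos_taylor2.
Qed.

Lemma cos_taylor4 (x : R) : Rabs x <= 1 ->
  Rabs (cos x - (1 - x ^ 2 / 2)) <= 1 * Rabs x ^ 4.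
Proof.
  revert x. apply (taylor_step _ (fun x => - (sin x - x))).
  { lra. } { rewrite cos_0. field. }
  { intros x. auto_derive; [trivial|]. field. }
  intros x Hx. rewrite Rabs_Ropp. now apply sin_taylor3.
Qed.

Lemma sin_taylor5 (x : R) : Rabs x <= 1 ->
  Rabs (sin x - (x - x ^ 3 / 6)) <= 1 * Rabs x ^ 5.
Proof.
  revert x. apply (taylor_step _ (fun x => cos x - (1 - x ^ 2 / 2))).
  { lra. } { rewrite sin_0. field. }
  { intros x. auto_derive; [trivial|]. field. }
  exact cos_taylor4.
Qed.

Lemma bigO_real (n : nat) (f : R -> R) (p : C -> R) (K : R) :
  0 <= K -> (forall z, Rabs (p z) <= Cmod z) ->
  (forall x, Rabs x <= 1 -> Rabs (f x) <= K * Rabs x ^ n) ->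
  bigO n (fun z => RtoC (f (p z))).
Proof.
  intros HK Hp Hf. apply (bigO_intro _ _ K 1); [lra|].
  intros z Hz. rewrite Cmod_R. assert (Hpz := Hp z).
  eapply Rle_trans; [apply Hf; lra|].
  apply Rmult_le_compat_l; [assumption|].
  apply pow_incr. split; [apply Rabs_pos | apply Hp].
Qed.

Lemma Rabs_im_le_Cmod (z : C) : Rabs (Im z) <= Cmod z.
Proof. eapply Rle_trans; [apply Rmax_r | apply Rmax_Cmod]. Qed.

(** [Cexp] is built from real functions, so it is split as exp(X) exp(W) with X = Re z and W = i Im
    z, and each factor is replaced by its cubic Taylor polynomial T. *)
Lemma Cexp_jet : jet Cexp 1 1 (/ 2) (/ 6).
Proof.
  set (X := fun z : C => RtoC (Re z)).
  set (W := fun z : C => (Ci * RtoC (Im z))%C).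
  set (E1 := fun z : C =>
    RtoC (exp (Re z) - (1 + Re z + Re z ^ 2 / 2 + Re z ^ 3 / 6))).
  set (E2 := fun z : C => RtoC (cos (Im z) - (1 - Im z ^ 2 / 2))).
  set (E3 := fun z : C => RtoC (sin (Im z) - (Im z - Im z ^ 3 / 6))).
  assert (HE1 : bigO 4 E1)
    by exact (bigO_real 4 (fun x => exp x - (1 + x + x ^ 2 / 2 + x ^ 3 / 6)) Re 3
                ltac:(lra) re_le_Cmod exp_taylor3).
  assert (HE2 : bigO 4 E2)
    by exact (bigO_real 4 (fun x => cos x - (1 - x ^ 2 / 2)) Im 1
                ltac:(lra) Rabs_im_le_Cmod cos_taylor4).
  assert (HE3 : bigO 4 E3).
  { apply (bigO_le 5); [lia|].
    exact (bigO_real 5 (fun x => sin x - (x - x ^ 3 / 6)) Im 1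
             ltac:(lra) Rabs_im_le_Cmod sin_taylor5). }
  assert (HX : bigO 1 X).
  { apply (bigO_real 1 (fun x => x) Re 1); [lra | exact re_le_Cmod|].
    intros; rewrite pow_1; lra. }
  assert (HW : bigO 1 W).
  { apply bigO_scal, (bigO_real 1 (fun x => x) Im 1); [lra | exact Rabs_im_le_Cmod|].
    intros; rewrite pow_1; lra. }
  assert (HE : bigO 4 (fun z => E2 z + Ci * E3 z)%C)
    by (apply bigO_add; [|apply bigO_scal]; assumption).
  set (T := fun z : C => (1 + z + / 2 * (z * z) + / 6 * (z * z * z))%C).
  assert (HT : forall Y, bigO 1 Y -> bigO 0 (fun z => T (Y z))).
  { intros Y HY. assert (HY0 : bigO 0 Y) by now apply (bigO_le 1); [lia|].
    unfold T. repeat apply bigO_add; try apply bigO_const; try assumption;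
      apply bigO_scal; repeat apply (bigO_mul 0 0); assumption. }
  assert (Hdec : forall z, Cexp z =
    ((T (X z) + E1 z) * (T (W z) + (E2 z + Ci * E3 z)))%C).
  { intros [x y]. unfold Cexp, T, X, W, E1, E2, E3.
    replace (T (X (x, y)) + E1 (x, y))%C with (RtoC (exp x)).
    all: unfold T, X, W, E1, E2, E3, Cexp, Re, Im, Ci, Cplus, Cmult, Cinv, RtoC;
      simpl; f_equal; field. }
  (* The last product is T(X) T(W) minus the terms of degree at most 3, which make up T(X + W);
     every remaining monomial contains X W and has degree at least 4. *)
  apply (bigO_ext _ (fun z =>
    (T (X z) * (E2 z + Ci * E3 z)
     + E1 z * (T (W z) + (E2 z + Ci * E3 z)))
    + (X z * W z) * ((X z * X z) * (/ 6)
                     + (X z * W z) * (/ 4 + / 12 * X z + / 12 * W z + / 36 * (X z * W z))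
                     + (W z * W z) * (/ 6)))%C).
  { intros z. rewrite Hdec.
    assert (Hz : z = (X z + W z)%C)
      by (destruct z as [x y]; unfold X, W, Ci, Re, Im, Cplus, Cmult, RtoC; simpl;
          f_equal; ring).
    replace (cubic 1 1 (/ 2) (/ 6) z) with (cubic 1 1 (/ 2) (/ 6) (X z + W z)%C)
      by now rewrite <- Hz.
    unfold cubic, T. field. }
  apply bigO_add; [apply bigO_add|].
  - apply (bigO_mul 0 4); [now apply HT | assumption].
  - apply (bigO_mul 4 0); [assumption|]. apply bigO_add; [now apply HT|].
    apply (bigO_le 4); [lia | assumption].
  - assert (HXW : bigO 2 (fun z => X z * W z)%C) by now apply (bigO_mul 1 1).
    assert (HX0 : bigO 0 X) by now apply (bigO_le 1); [lia|].
    assert (HW0 : bigO 0 W) by now apply (bigO_le 1); [lia|].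
    apply (bigO_mul 2 2); [assumption|]. repeat apply bigO_add.
    + apply (bigO_mul 2 0); [now apply (bigO_mul 1 1) | apply bigO_const].
    + apply (bigO_mul 2 0); [assumption|].
      repeat apply bigO_add; try apply bigO_const; apply bigO_scal; try assumption.
      now apply (bigO_mul 0 0).
    + apply (bigO_mul 2 0); [now apply (bigO_mul 1 1) | apply bigO_const].
Qed.

(** * Positivity of Euler's integral *)

(** [RInt_gen] carries information only if the integral converges. For a positive integrand the
    proper integrals grow with the interval, so the bound M makes them converge to their supremum,
    which is at least the positive integral over [1, 2]. *)
Lemma RInt_gen_pos (f : R -> R) (M : R) :
  (forall t, 0 < t -> continuous f t) -> (forall t, 0 < t -> 0 < f t) ->
  (forall a b, 0 < a < b -> RInt f a b <= M) ->
  0 < RInt_gen f (at_right 0) (Rbar_locally p_infty).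
Proof.
  intros Hc Hp HM.
  assert (Hex : forall a b, 0 < a -> a <= b -> ex_RInt f a b).
  { intros a b Ha Hab. apply (ex_RInt_continuous (V := R_CompleteNormedModule)).
    intros t Ht. rewrite Rmin_left, Rmax_right in Ht by lra. apply Hc. lra. }
  assert (Hpos : forall a b, 0 < a -> a <= b -> 0 <= RInt f a b).
  { intros a b Ha Hab. apply RInt_ge_0; [lra | now apply Hex|].
    intros t Ht. left. apply Hp. lra. }
  assert (Hmono : forall a b a' b', 0 < a' -> a' <= a -> a <= b -> b <= b' ->
    RInt f a b <= RInt f a' b').
  { intros a b a' b' H1 H2 H3 H4.
    rewrite <- (RInt_Chasles f a' a b') by (apply Hex; lra).
    rewrite <- (RInt_Chasles f a b b') by (apply Hex; lra).
    assert (A1 := Hpos a' a H1 H2). assert (A2 := Hpos b b' ltac:(lra) H4).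
    unfold plus; simpl. lra. }
  destruct (completeness (fun x => exists a b, 0 < a < b /\ x = RInt f a b))
    as [S [HSub HSlub]].
  { exists M. intros x (a & b & Hab & ->). now apply HM. }
  { exists (RInt f 1 2), 1, 2. split; [lra | reflexivity]. }
  assert (HS : is_RInt_gen f (at_right 0) (Rbar_locally p_infty) S).
  { apply filterlimi_locally. intros eps.
    assert (Hnear : exists a b, 0 < a < b /\ S - eps < RInt f a b).
    { apply NNPP. intros Hno.
      assert (S <= S - eps); [|assert (A := cond_pos eps); lra].
      apply HSlub. intros x (a & b & Hab & ->). apply Rnot_lt_le. intros Hlt.
      apply Hno. now exists a, b. }
    destruct Hnear as (a & b & Hab & Hlt).
    apply (Filter_prod _ _ _ (fun x => 0 < x < a) (fun y => b < y)).
    - exists (mkposreal a (proj1 Hab)). simpl. intros y Hy Hy0.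
      unfold ball in Hy; simpl in Hy; unfold AbsRing_ball, abs, minus, plus, opp in Hy;
        simpl in Hy.
      apply Rabs_lt_between in Hy. lra.
    - exists b. auto.
    - intros x y Hx Hy. simpl. exists (RInt f x y). split.
      + apply (RInt_correct (V := R_CompleteNormedModule)). apply Hex; lra.
      + assert (A1 := Hmono a b x y ltac:(lra) ltac:(lra) ltac:(lra) ltac:(lra)).
        assert (A2 : RInt f x y <= S).
        { apply HSub. exists x, y. split; [lra | reflexivity]. }
        unfold ball; simpl; unfold AbsRing_ball, abs, minus, plus, opp; simpl.
        apply Rabs_lt_between. assert (A := cond_pos eps). lra. }
  rewrite (is_RInt_gen_unique _ _ HS).
  apply Rlt_le_trans with (RInt f 1 2).
  - apply RInt_gt_0; [lra | intros; apply Hp; lra|].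
    intros t Ht. apply Hc. lra.
  - apply HSub. exists 1, 2. split; [lra | reflexivity].
Qed.

Lemma exp_le_compat (x y : R) : x <= y -> exp x <= exp y.
Proof.
  intros [H| ->]; [left; now apply exp_increasing | apply Rle_refl].
Qed.

Lemma Gamma_pos (x : R) : 1 <= x -> 0 < Gamma x.
Proof.
  intros Hx. unfold Gamma.
  set (s := x - 1). assert (Hs : 0 <= s) by (unfold s; lra).
  (* From ln t <= t / c + ln c one gets s ln t <= t / 2 + s ln c, so half of the exponential decay
     survives; s + 1 in place of s keeps c positive for s = 0. *)
  set (c := 2 * (s + 1)). assert (Hc : 0 < c) by (unfold c; lra).
  set (K := exp (s * ln c)).
  assert (Hbd : forall t, 0 < t -> Rpower t s * exp (- t) <= K * exp (- (t / 2))).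
  { intros t Ht. unfold K, Rpower. rewrite <- !exp_plus.
    assert (Hln : ln t <= t / c + ln c).
    { replace t with (t / c * c) at 1 by (field; lra).
      rewrite ln_mult; [|apply Rdiv_lt_0_compat; lra|lra].
      assert (0 < t / c) by (apply Rdiv_lt_0_compat; lra).
      assert (ln (t / c) <= t / c); [|lra].
      rewrite <- (ln_exp (t / c)) at 2. apply ln_le; [assumption|].
      assert (A := exp_ineq1_le (t / c)). lra. }
    assert (Hst : s * ln t <= s * (t / c + ln c)) by now apply Rmult_le_compat_l.
    assert (Hsc : s * (t / c) <= t / 2).
    { replace (s * (t / c)) with (t / 2 * (s / (s + 1)))
        by (unfold c; field; lra).
      assert (s / (s + 1) <= 1).
      { apply (Rmult_le_reg_r (s + 1)); [lra|]. unfold Rdiv.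
        rewrite Rmult_assoc, Rinv_l by lra. lra. }
      nra. }
    apply exp_le_compat. lra. }
  apply (RInt_gen_pos _ (2 * K)).
  - intros t Ht. apply (ex_derive_continuous (V := R_NormedModule)).
    unfold Rpower. auto_derive. lra.
  - intros t Ht. apply Rmult_lt_0_compat; apply exp_pos.
  - intros a b Hab.
    assert (HI : is_RInt (fun t => K * exp (- (t / 2))) a b
                   (- 2 * K * exp (- (b / 2)) - - 2 * K * exp (- (a / 2)))).
    { apply (is_RInt_derive (fun t => - 2 * K * exp (- (t / 2)))).
      - intros t _. auto_derive; [trivial|]. unfold Rdiv. field.
      - intros t _. apply (ex_derive_continuous (V := R_NormedModule)).
        auto_derive. trivial. }
    apply Rle_trans with (RInt (fun t => K * exp (- (t / 2))) a b).
    + apply RInt_le; [lra| |now exists (- 2 * K * exp (- (b / 2)) - - 2 * K * exp (- (a / 2)))|].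
      * apply (ex_RInt_continuous (V := R_CompleteNormedModule)).
        intros t Ht. rewrite Rmin_left in Ht by lra.
        apply (ex_derive_continuous (V := R_NormedModule)).
        unfold Rpower. auto_derive. lra.
      * intros t Ht. apply Hbd. lra.
    + rewrite (is_RInt_unique _ _ _ _ HI).
      assert (0 < exp (- (b / 2))) by apply exp_pos.
      assert (exp (- (a / 2)) <= 1).
      { rewrite <- exp_0. apply exp_le_compat. lra. }
      assert (0 < K) by apply exp_pos. nra.
Qed.

Lemma Cbin_pos (delta : R) (n : nat) :
  0 <= delta -> (1 <= n)%nat -> 0 < Cbin delta n.
Proof.
  intros Hd Hn. assert (H1 : INR 1 <= INR n) by now apply le_INR.
  simpl in H1. unfold Cbin.
  apply Rdiv_lt_0_compat; [|apply Rmult_lt_0_compat]; apply Gamma_pos; lra.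
Qed.

(** * Coefficient estimates *)

Lemma class_A_jet (h : C -> C) (c : nat -> C) :
  class_A h c -> jet h 0 1 (c 2%nat) (c 3%nat).
Proof.
  intros (H0 & H1 & H). rewrite <- H0, <- H1.
  apply (C_psum_jet c h 1); [lra | exact H].
Qed.

(** The composite g(f(z)) is z near 0, and its coefficients of z^2 and z^3 are a2 + b2 and a3 + 2 a2
    b2 + b3. *)
Lemma inverse_coefs (f g : C -> C) (a b : nat -> C) :
  class_A f a -> class_A g b -> extended_inverse f g ->
  b 2%nat = (- a 2%nat)%C /\ b 3%nat = (2 * (a 2%nat * a 2%nat) - a 3%nat)%C.
Proof.
  intros Hf Hg (_ & _ & r & Hr).
  apply class_A_jet in Hf. apply class_A_jet in Hg.
  assert (HO : bigO 1 f).
  { generalize (jet_bigO1 _ _ _ _ _ Hf). apply bigO_ext. intros; ring. }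
  destruct (bigO_small f r (cond_pos r) HO) as (d & Hd & Hsmall).
  assert (Hj := jet_comp _ _ _ _ _ _ _ _ _ Hg Hf).
  apply (jet_ext_loc _ (fun z => z) _ _ _ _ (Rmin d 1)) in Hj.
  - destruct (jet_unique _ _ _ _ _ _ _ _ _ Hj jet_id) as (_ & _ & E2 & E3).
    assert (B2 : b 2%nat = (- a 2%nat)%C).
    { replace (b 2%nat) with ((1 * a 2%nat + b 2%nat * (1 * 1)) - a 2%nat)%C by ring.
      rewrite E2. ring. }
    split; [assumption|]. rewrite B2 in E3.
    replace (b 3%nat) with
      ((1 * a 3%nat + - a 2%nat * (2 * (1 * a 2%nat)) + b 3%nat * (1 * 1 * 1))
       - a 3%nat + 2 * (a 2%nat * a 2%nat))%C by ring.
    rewrite E3. ring.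
  - apply Rmin_pos; lra.
  - intros z Hz. apply Hr.
    + unfold U, Defs.disc. eapply Rlt_le_trans; [exact Hz | apply Rmin_r].
    + apply Hsmall. eapply Rlt_le_trans; [exact Hz | apply Rmin_l].
Qed.

(** F = z exp(L) determines the logarithm: l1 = d2 and l2 = d3 - d2^2 / 2. Multiplying the jet of
    exp((gamma - 1) L) by 1 + 2 d2 z + 3 d3 z^2 gives the left sides; composing phi with the Schwarz
    function gives the right sides. *)
Lemma power_quotient_coefs (gamma : R) (F phi : C -> C) (d : nat -> C) (b1 b2 b3 : C) :
  d 0%nat = RtoC 0 -> d 1%nat = RtoC 1 ->
  (forall z, U z -> C_psum d z (F z)) ->
  jet phi 1 b1 b2 b3 ->
  power_quotient_subordinate gamma F phi ->
  exists u1 u2 : C,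
    Cmod u2 + Cmod u1 ^ 2 <= 1 /\ Cmod u1 <= 1 /\
    (RtoC (gamma + 1) * d 2%nat = b1 * u1)%C /\
    (RtoC (gamma + 2) * d 3%nat
       + RtoC ((gamma - 1) * (gamma + 2) / 2) * (d 2%nat * d 2%nat)
     = b1 * u2 + b2 * (u1 * u1))%C.
Proof.
  intros Hd0 Hd1 HF Hphi (P & (HP & r & L & HL & HL0 & HFP) & (w & Hw & Hw0 & Hsub)).
  assert (HFj := C_psum_jet d F 1 ltac:(lra) HF). rewrite Hd0, Hd1 in HFj.
  destruct (analytic_jet_0 _ _ HL) as (l1 & l2 & l3 & HLj).
  { unfold Defs.disc. rewrite Cmod_0. apply cond_pos. }
  rewrite HL0 in HLj.
  assert (HexpL := jet_comp _ _ _ _ _ _ _ _ _ Cexp_jet HLj).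
  assert (HFj' := jet_mul _ _ _ _ _ _ _ _ _ _ jet_id HexpL).
  apply (jet_ext_loc _ F _ _ _ _ r) in HFj';
    [| apply cond_pos | intros z Hz; symmetry; apply (HFP z Hz)].
  destruct (jet_unique _ _ _ _ _ _ _ _ _ HFj HFj') as (_ & _ & E2 & E3).
  assert (HsL := jet_scal (RtoC (gamma - 1)) _ _ _ _ _ HLj).
  replace (RtoC (gamma - 1) * RtoC 0)%C with (RtoC 0) in HsL by ring.
  assert (HPj := jet_comp _ _ _ _ _ _ _ _ _ Cexp_jet HsL).
  apply (jet_ext_loc _ P _ _ _ _ r) in HPj;
    [| apply cond_pos | intros z Hz; symmetry; apply (HFP z Hz)].
  destruct (C_psum_derive d F 1 ltac:(lra) HF) as (e & He & HD).
  assert (HDj := C_psum_jet _ _ e He HD).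
  assert (Hprod := jet_mul _ _ _ _ _ _ _ _ _ _ HDj HPj).
  destruct (analytic_jet_0 _ _ Hw) as (u1 & u2 & u3 & Hwj).
  { unfold U, Defs.disc. rewrite Cmod_0. lra. }
  rewrite Hw0 in Hwj.
  assert (Hcomp := jet_comp _ _ _ _ _ _ _ _ _ Hphi Hwj).
  apply (jet_ext_loc _ (fun z => C_derive F z * P z)%C _ _ _ _ 1) in Hcomp;
    [| lra | intros z Hz; symmetry; apply (Hsub z Hz)].
  destruct (jet_unique _ _ _ _ _ _ _ _ _ Hprod Hcomp) as (_ & Q1 & Q2 & _).
  destruct (schwarz_second_coef w u1 u2 u3) as (Hu1 & Hu2).
  - intros z Hz. now apply (analytic_has_jet U).
  - assumption.
  - intros z Hz. apply (Hsub z Hz).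
  - exists u1, u2. split; [lra|]. split; [assumption|].
    rewrite Hd1 in Q1, Q2. simpl INR in Q1, Q2.
    replace (l1) with (d 2%nat) in * by (rewrite E2; ring).
    replace (l2) with (d 3%nat - / 2 * (d 2%nat * d 2%nat))%C in * by (rewrite E3; ring).
    split; [rewrite <- Q1 | rewrite <- Q2];
      rewrite ?RtoC_div, ?RtoC_mult, ?RtoC_plus, ?RtoC_minus by lra; field.
Qed.

(** Upsilon_3 = 2^k Upsilon_2. *)
Lemma Upsilon_2_pos (alpha beta lambda : R) (k : nat) :
  0 < Upsilon alpha beta lambda k 3 -> 0 < Upsilon alpha beta lambda k 2.
Proof.
  unfold Upsilon. intros H.
  replace (lambda * (alpha + beta - 1) * (INR 3 - 1))
    with (2 * (lambda * (alpha + beta - 1) * (INR 2 - 1))) in H by (simpl; ring).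
  rewrite Rpow_mult_distr in H.
  assert (0 < 2 ^ k) by (apply pow_lt; lra).
  apply (Rmult_lt_reg_l (2 ^ k)); lra.
Qed.

Theorem theorem2p1
  (k : nat) (alpha beta lambda delta gamma : R)
  (halpha : 0 < alpha <= 1) (hbeta : 0 < beta <= 1)
  (hlambda : 0 <= lambda) (hdelta : 0 <= delta) (hgamma : 0 <= gamma)
  (phi : C -> C) (B : nat -> C) (B1 : R)
  (hphi : forall z : C, U z -> C_psum B z (phi z))
  (hB0 : B 0%nat = RtoC 1) (hB1 : B 1%nat = RtoC B1) (hB1pos : 0 < B1)
  (f : C -> C) (a : nat -> C)
  (hf : class_A f a)
  (hmem : class_B k alpha beta delta lambda gamma phi f) :
  let T2 := Upsilon alpha beta lambda k 2 * Cbin delta 2 in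
  let T3 := Upsilon alpha beta lambda k 3 * Cbin delta 3 in
  let E : C :=
    (RtoC (B1 ^ 2 * (2 * (gamma + 2) * T3
                     + (gamma - 1) * (gamma + 2) * T2 ^ 2))
     - RtoC 2 * (B 2%nat - RtoC B1) * RtoC ((gamma + 1) ^ 2 * T2 ^ 2))%C in
  (E <> RtoC 0 -> Cmod (a 2%nat) <= B1 * sqrt (2 * B1) / sqrt (Cmod E)) /\
  (0 < Upsilon alpha beta lambda k 3 ->
     Cmod (a 3%nat) <= B1 / ((gamma + 2) * T3) + (B1 / ((gamma + 1) * T2)) ^ 2).
Proof.
  intros T2 T3 E.
  destruct hmem as (_ & g & Df & Dg & Hinv & (af & Haf & HDf) & (bg & Hbg & HDg)
                    & Hqf & Hqg).
  destruct (inverse_coefs f g af bg Haf Hbg Hinv) as [Hb2 Hb3].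
  (* Membership in the class supplies its own coefficient sequence for f; uniqueness of jets
     identifies it with [a] where it matters. *)
  destruct (jet_unique _ _ _ _ _ _ _ _ _ (class_A_jet _ _ Haf) (class_A_jet _ _ hf))
    as (_ & _ & Ha2 & Ha3).
  assert (Hphij := C_psum_jet B phi 1 ltac:(lra) hphi). rewrite hB0, hB1 in Hphij.
  destruct (power_quotient_coefs gamma Df phi _ _ _ _ eq_refl eq_refl HDf Hphij Hqf)
    as (u1 & u2 & Hu & Hu1 & P1 & P2).
  destruct (power_quotient_coefs gamma Dg phi _ _ _ _ eq_refl eq_refl HDg Hphij Hqg)
    as (v1 & v2 & Hv & Hv1 & Q1 & Q2).
  simpl D_coef in P1, P2, Q1, Q2. fold T2 T3 in P1, P2, Q1, Q2.
  rewrite Hb2, ?Hb3, Ha2, ?Ha3 in Q1. rewrite Hb2, Hb3, Ha2, Ha3 in Q2.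
  rewrite Ha2 in P1. rewrite Ha2, Ha3 in P2.
  assert (HT : 0 < Upsilon alpha beta lambda k 3 -> 0 < T2 /\ 0 < T3).
  { intros HU3. assert (HU2 := Upsilon_2_pos _ _ _ _ HU3).
    split; apply Rmult_lt_0_compat; try assumption; apply Cbin_pos; lia || lra. }
  clearbody T2 T3.
  set (x := a 2%nat) in *. set (y := a 3%nat) in *.
  set (b := B 2%nat) in *.
  assert (HB1 : RtoC B1 <> 0) by (intros H; apply RtoC_inj in H; lra).
  assert (Hv1u1 : v1 = (- u1)%C).
  { replace v1 with (/ RtoC B1 * (B1 * v1))%C by (field; assumption).
    rewrite <- Q1.
    replace u1 with (/ RtoC B1 * (B1 * u1))%C by (field; assumption).
    rewrite <- P1. ring. }
  split.
  - intros HE.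
    assert (HEx : (E * (x * x)
                   = B1 * B1 * B1 * (u2 + v2 + u1 * u1 + u1 * u1))%C).
    (* Adding the two z^2-relations cancels a3. The multiple of (B1 u1)^2, known from the
       z-relation, then turns the coefficient B2 of u1^2 into B1; this is the source of B2 - B1 in
       E. *)
    { replace (B1 * B1 * B1 * (u2 + v2 + u1 * u1 + u1 * u1))%C
        with (B1 * B1 * ((B1 * u2 + b * (u1 * u1)) + (B1 * v2 + b * (v1 * v1)))
              + 2 * (B1 - b) * ((B1 * u1) * (B1 * u1)))%C
        by (rewrite Hv1u1; ring).
      rewrite <- P1, <- P2, <- Q2. unfold E.
      repeat rewrite ?RtoC_div, ?RtoC_minus, ?RtoC_mult, ?RtoC_pow, ?RtoC_plus by lra.
      field. }
    assert (HEpos : 0 < Cmod E) by now apply Cmod_gt_0.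
    assert (Hmod : Cmod E * Cmod x ^ 2 <= 2 * B1 ^ 3).
    { replace (Cmod E * Cmod x ^ 2) with (Cmod (E * (x * x)))
        by (rewrite !Cmod_mult; ring).
      rewrite HEx, !Cmod_mult, Cmod_R, Rabs_pos_eq by lra.
      (* As |v1| = |u1|, one u1^2 is charged to u2 and the other to v2, each pair being at most
         1. *)
      assert (Hs : Cmod (u2 + v2 + u1 * u1 + u1 * u1) <= 2).
      { rewrite Hv1u1, Cmod_opp in Hv.
        assert (A1 := Cmod_triangle (u2 + v2 + u1 * u1) (u1 * u1)).
        assert (A2 := Cmod_triangle (u2 + v2) (u1 * u1)).
        assert (A3 := Cmod_triangle u2 v2).
        rewrite Cmod_mult in A1, A2. lra. }
      assert (0 < B1 ^ 3) by now apply pow_lt.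
      replace (B1 * B1 * B1) with (B1 ^ 3) by ring. nra. }
    assert (Hsq : 0 < sqrt (Cmod E)) by now apply sqrt_lt_R0.
    apply (Rmult_le_reg_r (sqrt (Cmod E))); [assumption|].
    unfold Rdiv. rewrite Rmult_assoc, Rinv_l, Rmult_1_r by lra.
    apply Rle_of_pow2_le.
    + apply Rmult_le_pos; [apply Cmod_ge_0 | lra].
    + apply Rmult_le_pos; [lra | apply sqrt_pos].
    + rewrite !Rpow_mult_distr, !pow2_sqrt by lra. lra.
  - intros HU3. destruct (HT HU3) as [HT2 HT3].
    assert (Hx : Cmod x <= B1 / ((gamma + 1) * T2)).
    { assert (Hg : 0 < (gamma + 1) * T2) by (apply Rmult_lt_0_compat; lra).
      assert (HP := f_equal Cmod P1).
      rewrite !Cmod_mult, !Cmod_R, !Rabs_pos_eq in HP by lra.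
      apply (Rmult_le_reg_r ((gamma + 1) * T2)); [assumption|].
      unfold Rdiv. rewrite Rmult_assoc, Rinv_l by lra. nra. }
    assert (Hyx : Cmod (y - x * x) <= B1 / ((gamma + 2) * T3)).
    { assert (Hg : 0 < (gamma + 2) * T3) by (apply Rmult_lt_0_compat; lra).
      assert (HD : (2 * (RtoC (gamma + 2) * T3 * (y - x * x)) = B1 * (u2 - v2))%C).
      { replace (B1 * (u2 - v2))%C
          with ((B1 * u2 + b * (u1 * u1)) - (B1 * v2 + b * (v1 * v1)))%C
          by (rewrite Hv1u1; ring).
        rewrite <- P2, <- Q2. ring. }
      apply (f_equal Cmod) in HD.
      rewrite !Cmod_mult, !Cmod_R, !Rabs_pos_eq in HD by lra.
      assert (A := Cmod_triangle u2 (- v2)). rewrite Cmod_opp in A.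
      assert (A1 := pow2_ge_0 (Cmod u1)). assert (A2 := pow2_ge_0 (Cmod v1)).
      change (u2 + - v2)%C with (u2 - v2)%C in A.
      apply (Rmult_le_reg_r ((gamma + 2) * T3)); [assumption|].
      unfold Rdiv. rewrite Rmult_assoc, Rinv_l by lra. nra. }
    replace y with ((y - x * x) + x * x)%C by ring.
    eapply Rle_trans; [apply Cmod_triangle|]. apply Rplus_le_compat; [assumption|].
    rewrite Cmod_mult. assert (A := Cmod_ge_0 x).
    replace (Cmod x * Cmod x) with (Cmod x ^ 2) by ring.
    apply pow_incr. now split.
Qed.
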